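(* Let $\mathscr{A}$ be an MAT-free arrangement in $V\cong\mathbb{K}^\ell$ ($\mathbb{K}=\mathbb{R}$ or $\mathbb{C}$) with MAT-partition $\pi=(\pi_1|\cdots|\pi_n)$ and exponents $\exp(\mathscr{A})=(e_1\le\dots\le e_\ell)$; put $\pi_{n+1}=\varnothing$. Then for each $1\le k\le n$ and each $|\pi_{k+1}|\le q\le|\pi_k|$ there is a subset $\mathscr{C}\subseteq\pi_k$ with $|\mathscr{C}|=q$ such that for $X:=\bigcap_{H\in\mathscr{C}}H$ the restriction $\mathscr{A}^X$ is free with exponents $\exp(\mathscr{A}^X)=(e_1\le\dots\le e_{\ell-q})$. Furthermore, there is a basis $\theta_1,\dots,\theta_\ell$ of $D(\mathscr{A})$ such that $\theta_1^X,\dots,\theta_{\ell-q}^X$ is a basis of $D(\mathscr{A}^X)$.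
   Context: An arrangement is a finite set $\mathscr{A}$ of linear hyperplanes of $V$. For $X$ an intersection of members of $\mathscr{A}$ (empty intersection $=V$), $\mathscr{A}^X=\{H\cap X\mid H\in\mathscr{A},H\not\supseteq X\}$ is the restriction, an arrangement in $X$. $\mathrm{rk}(\mathscr{B})=\ell-\dim\bigcap_{H\in\mathscr{B}}H$. Let $S=\mathrm{Sym}(V^* )\cong\mathbb{K}[x_1,\dots,x_\ell]$, $H=\ker\alpha_H$. $D(\mathscr{A})=\{\theta\in\mathrm{Der}_{\mathbb{K}}(S)\mid\theta(\alpha_H)\in\alpha_HS\ \forall H\in\mathscr{A}\}$. $\theta=\sum f_i\,\partial/\partial x_i$ is homogeneous of degree $p$ if all $f_i$ are homogeneous of degree $p$ (or zero). $\mathscr{A}$ is free if $D(\mathscr{A})$ is a free $S$-module; its exponents are the degrees of a homogeneous basis. For $X$ an intersection of members of $\mathscr{A}$, let $P_X\subset S$ be the ideal generated by the $\alpha_H$ with $H\in\mathscr{A}$, $H\supseteq X$; then $S/P_X$ is the coordinate ring of $X$, and each $\theta\in D(\mathscr{A})$ induces its restriction $\theta^X\in D(\mathscr{A}^X)$, $\theta^X(f+P_X)=\theta(f)+P_X$. MAT-free with MAT-partition $\pi$: $\pi=(\pi_1|\cdots|\pi_n)$ is an ordered partition of $\mathscr{A}$ such that, with $\mathscr{A}_0$ the empty arrangement in $V$ and $\mathscr{A}_k=\bigcup_{i=1}^k\pi_i$, for every $0\le k\le n-1$: (1) $\mathrm{rk}(\pi_{k+1})=|\pi_{k+1}|$;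 (2) $\bigcap_{H\in\pi_{k+1}}H\not\subseteq\bigcup_{H'\in\mathscr{A}_k}H'$; (3) $|\mathscr{A}_k|-|(\mathscr{A}_k\cup\{H\})^H|=k$ for each $H\in\pi_{k+1}$. (Such $\mathscr{A}$ is free.) *)

(* Defs.v *)
From HB Require Import structures.
From mathcomp Require Import all_boot all_order all_algebra.
From mathcomp Require Import finmap mpoly complex.
From mathcomp Require Import boolp classical_sets reals.

Set Implicit Arguments.
Unset Strict Implicit.
Unset Printing Implicit Defensive.

Import Order.TTheory GRing.Theory Num.Theory.

Local Open Scope ring_scope.

Definition real_or_complex (K : fieldType) : Prop :=
  exists R : realType,
    (exists f : {rmorphism R -> K}, bijective f) \/
    (exists f : {rmorphism R[i] -> K}, bijective f).

(* S = Sym(V^* ), written in the coordinates of the basis vbasis {:V}: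
   'X_i is the i-th coordinate function. *)

Section Arrangements.
Variables (K : fieldType) (V : vectType K).
Implicit Types (A B C : {fset {vspace V}}) (X H : {vspace V}).
Implicit Type a : 'Hom(V, K^o).

Local Notation S := {mpoly K[\dim {:V}]}.

Definition is_arrangement A : Prop :=
  forall H, H \in A -> (\dim H).+1 = \dim {:V}.

Definition center A : {vspace V} := (\bigcap_(H <- A) H)%VS.

Definition rk A : nat := (\dim {:V} - \dim (center A))%N.

(* A^X lives in X, viewed as a vector space in its own right: H :&: X is the
   preimage of H under the inclusion of X in V. *)
Definition restriction A X : {fset {vspace subvs_of X}} :=
  [fset (linfun (@vsval K V X) @^-1: H)%VS | H in A & ~~ (X <= H)%VS]%fset.

Definition linpoly a : S :=
  \sum_(i < \dim {:V}) a (vbasis {:V})`_i *: 'X_i.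

Definition is_derivation (theta : S -> S) : Prop :=
  linear theta /\
  forall p q : S, theta (p * q) = theta p * q + p * theta q.

(* alpha_H is determined by H = ker alpha_H up to a nonzero scalar, so that the
   condition does not depend on the form a chosen. *)
Definition logder A (theta : S -> S) : Prop :=
  is_derivation theta /\
  forall H a, H \in A -> lker a = H ->
    exists g : S, theta (linpoly a) = linpoly a * g.

(* theta = \sum_i theta('X_i) d/dx_i *)
Definition homog_der (d : nat) (theta : S -> S) : Prop :=
  forall i, theta 'X_i \is d.-homog.

Definition is_basis (D : (S -> S) -> Prop) m (theta : 'I_m -> S -> S) : Prop :=
  [/\ forall i, D (theta i),
      forall eta, D eta -> exists c : 'I_m -> S,
        forall p, eta p = \sum_(i < m) c i * theta i p
    & forall c : 'I_m -> S,
        (forall p, \sum_(i < m) c i * theta i p = 0) -> forall i, c i = 0].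

(* As S is noetherian, a basis of the S-module D(A) is finite. *)
Definition is_free A : Prop :=
  exists m (theta : 'I_m -> S -> S), is_basis (logder A) theta.

Definition has_exponents A (e : seq nat) : Prop :=
  exists theta : 'I_(size e) -> S -> S,
    is_basis (logder A) theta /\ forall i : 'I_(size e), homog_der (nth 0%N e i) (theta i).

(* The exponents in nondecreasing order (the empty sequence by default when
   there is no homogeneous basis). *)
Definition exponents A : seq nat :=
  xget [::] [set e | sorted leq e /\ has_exponents A e]%classic.

Definition is_ordered_partition A (pi : seq {fset {vspace V}}) : Prop :=
  [/\ fset0%fset \notin pi,
      pairwise (fun B C => [disjoint B & C]%fset) pi
    & (\bigcup_(B <- pi) B)%fset = A].

(* The k-th block, counted from 1; it is empty for k = (size pi).+1. *)
Definition block (pi : seq {fset {vspace V}}) (k : nat) : {fset {vspace V}} :=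
  nth fset0%fset pi k.-1.

Definition stage (pi : seq {fset {vspace V}}) (k : nat) : {fset {vspace V}} :=
  (\bigcup_(B <- take k pi) B)%fset.

(* The last condition is |A_k| - |(A_k U {H})^H| = k without subtraction. *)
Definition is_MAT_partition A (pi : seq {fset {vspace V}}) : Prop :=
  is_ordered_partition A pi /\
  forall k, (k < size pi)%N ->
    [/\ rk (block pi k.+1) = #|` block pi k.+1|,
        ~ (forall v, v \in center (block pi k.+1) ->
             exists2 H, H \in stage pi k & v \in H)
      & forall H, H \in block pi k.+1 ->
          #|` stage pi k| =
            (#|` restriction (H |` stage pi k)%fset H| + k)%N].

End Arrangements.

Section Pullback.
Variable K : fieldType.
Implicit Types U V W : vectType K.

(* The algebra morphism Sym(V^* ) -> Sym(W^* ) extending the transpose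
   V^* -> W^* of h. *)
Definition pullback V W (h : 'Hom(W, V)) (f : {mpoly K[\dim {:V}]}) :
    {mpoly K[\dim {:W}]} :=
  f \mPo [tuple linpoly (linfun (coord (vbasis {:V}) i : V -> K^o) \o h)%VF
         | i < \dim {:V}].

HB.instance Definition _ V W (h : 'Hom(W, V)) :=
  GRing.LRMorphism.copy (pullback h)
  (comp_mpoly [tuple linpoly (linfun (coord (vbasis {:V}) i : V -> K^o) \o h)%VF
              | i < \dim {:V}]).

Lemma linpoly_is_linear W :
  linear (@linpoly K W : 'Hom(W, K^o) -> {mpoly K[\dim {:W}]}).
Proof.
move=> c a b; rewrite /linpoly scaler_sumr -big_split; apply: eq_bigr => i _.
by rewrite add_lfunE scale_lfunE scalerDl scalerA.
Qed.

HB.instance Definition _ W :=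
  GRing.isLinear.Build K 'Hom(W, K^o) {mpoly K[\dim {:W}]} _ (@linpoly K W)
    (@linpoly_is_linear W).

Lemma linpoly_coord W i :
  linpoly (linfun (coord (vbasis {:W}) i : W -> K^o)) = 'X_i.
Proof.
have free_b := basis_free (vbasisP {:W}).
rewrite /linpoly (bigD1 i) //= big1 => [|j ji]; rewrite lfunE /= coord_free //.
  by rewrite eqxx scale1r addr0.
by rewrite (negPf ji) scale0r.
Qed.

Lemma pullbackX V W (h : 'Hom(W, V)) i :
  pullback h 'X_i =
    linpoly (linfun (coord (vbasis {:V}) i : V -> K^o) \o h)%VF.
Proof. by rewrite /pullback /comp_mpoly mmapX mmap1U tnth_mktuple. Qed.

Lemma pullback_linpoly V W (h : 'Hom(W, V)) (a : 'Hom(V, K^o)) :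
  pullback h (linpoly a) = linpoly (a \o h)%VF.
Proof.
rewrite {1}/linpoly linear_sum /=.
under eq_bigr => i _ do rewrite linearZ /= pullbackX -linearZ.
rewrite -linear_sum; congr linpoly; apply/lfunP => x.
rewrite sum_lfunE !comp_lfunE /= [in RHS](coord_vbasis (memvf (h x))) linear_sum.
apply: eq_bigr => i _; rewrite scale_lfunE comp_lfunE lfunE /= linearZ.
by rewrite /GRing.scale /= mulrC.
Qed.

Lemma pullback_id_surj V W (h : 'Hom(W, V)) (s : 'Hom(V, W)) g :
  (s \o h = \1)%VF -> exists f, pullback h f = g.
Proof.
move=> sh1; have coordP i : exists f, pullback h f = 'X_i.
  exists (linpoly (linfun (coord (vbasis {:W}) i : W -> K^o) \o s)%VF).
  by rewrite pullback_linpoly -comp_lfunA sh1 comp_lfun1r linpoly_coord.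
elim/mpolyind: g => [|c m p _ _ [f fE]]; first by exists 0; rewrite linear0.
have [F FE] : exists F, pullback h F = 'X_[m].
  rewrite mpolyXE_id; elim/big_ind: _ => [|_ _ [u <-] [v <-]|i _].
  - by exists 1; rewrite rmorph1.
  - by exists (u * v); rewrite rmorphM.
  - by have [u <-] := coordP i; exists (u ^+ m i); rewrite rmorphXn.
by exists (c *: F + f); rewrite linearP /= FE fE.
Qed.

End Pullback.

Section Restriction.
Variables (K : fieldType) (V : vectType K).

Local Notation SV := {mpoly K[\dim {:V}]}.
Local Notation SX X := {mpoly K[\dim {: subvs_of X}]}.
Implicit Types (X : {vspace V}) (a : 'Hom(V, K^o)).

(* Restriction of polynomial functions from V to X; by resS_surj and resS_eq0
   it identifies S / P_X with Sym(X^* ). *)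
Definition resS X : SV -> SX X := pullback (linfun (@vsval K V X)).

(* thetaX is the derivation induced by theta on S / P_X. *)
Definition is_restricted_der X (theta : SV -> SV) (thetaX : SX X -> SX X) : Prop :=
  forall f : SV, thetaX (resS X f) = resS X (theta f).

Lemma resS_surj X (g : SX X) : exists f, resS X f = g.
Proof.
apply: (@pullback_id_surj _ _ _ _ (linfun (vsproj X))).
by apply/lfunP => x; rewrite comp_lfunE id_lfunE lfunE /= lfunE /= vsvalK.
Qed.

Lemma hyperplane_ker (W : vectType K) (H : {vspace W}) :
  (\dim H).+1 = \dim {:W} -> exists a : 'Hom(W, K^o), lker a = H.
Proof.
move=> dimH; have /subvPn[u _ uH] : ~~ ({:W} <= H)%VS.
  by apply/negP => /dimvS; rewrite -dimH ltnn.
have u0 : u != 0 by apply: contraNneq uH => ->; rewrite mem0v.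
have uH0 : (<[u]> :&: H = 0)%VS.
  apply/eqP; rewrite -subv0; apply/subvP => v; rewrite memv_cap => /andP[].
  case/vlineP=> c -> cuH; rewrite memv0 scaler_eq0 (negPf u0) orbF.
  by apply: contraR uH => c0; rewrite -[u](scalerK c0) memvZ.
have uHH0 : (H :&: <[u]> = 0)%VS by rewrite capvC.
have free_u : free [tuple u] by rewrite seq1_free.
exists (linfun (coord [tuple u] ord0 : W -> K^o) \o daddv_pi <[u]> H)%VF.
set a := (X in lker X).
have aH v : v \in H -> a v = 0.
  move=> vH; have vuH : v \in (<[u]> + H)%VS by apply: subvP (addvSr _ _) _ vH.
  have := daddv_pi_add uH0 vuH; rewrite (daddv_pi_id uHH0 vH).
  move/(canRL (addrK v)); rewrite subrr => pi0.
  by rewrite comp_lfunE pi0 linear0.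
have au : a u = 1.
  rewrite comp_lfunE daddv_pi_id ?memv_line // lfunE /=.
  exact: (coord_free ord0 ord0 free_u).
apply/esym/eqP; rewrite eqEdim; apply/andP; split.
  by apply/subvP => v vH; rewrite memv_ker aH.
rewrite -ltnS dimH ltn_neqAle dimvS ?subvf // andbT.
apply/negP => /eqP dimE; have /eqP kerE : lker a == fullv.
  by rewrite eqEdim subvf dimE leqnn.
by have := memvf u; rewrite -kerE memv_ker au oner_eq0.
Qed.

(* The ideal P_X generated by the forms alpha_H, H in A, H containing X. *)
Definition defideal (A : {fset {vspace V}}) X (f : SV) : Prop :=
  exists r : seq ('Hom(V, K^o) * SV),
    (forall u, u \in r -> lker u.1 \in A /\ (X <= lker u.1)%VS) /\
    f = \sum_(u <- r) linpoly u.1 * u.2.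

Lemma defidealD A X f g :
  defideal A X f -> defideal A X g -> defideal A X (f + g).
Proof.
move=> [r [rA ->]] [t [tA ->]]; exists (r ++ t); split; last by rewrite big_cat.
by move=> u; rewrite mem_cat => /orP[/rA|/tA].
Qed.

Lemma defidealM A X f g : defideal A X f -> defideal A X (g * f).
Proof.
move=> [r [rA ->]]; exists [seq (u.1, g * u.2) | u <- r]; split.
  by move=> _ /mapP[u /rA uA ->].
by rewrite big_map mulr_sumr; apply: eq_bigr => u _; rewrite mulrCA.
Qed.

Lemma defideal0 A X : defideal A X 0.
Proof. by exists [::]; split=> //; rewrite big_nil. Qed.

Lemma center_le (C : {fset {vspace V}}) H : H \in C -> (center C <= H)%VS.
Proof.
by move=> HC; rewrite /center (big_rem H) //= capvSl.
Qed.

Lemma defideal_form A (C : {fset {vspace V}}) a :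
  is_arrangement A -> (C `<=` A)%fset -> (center C <= lker a)%VS ->
  defideal A (center C) (linpoly a).
Proof.
move=> hA /fsubsetP CA aC.
suff gen (s : seq {vspace V}) (U : {vspace V}) b :
    {subset s <= C} -> (U :&: \bigcap_(H <- s) H <= lker b)%VS ->
    exists2 b', (U <= lker (b - b'))%VS & defideal A (center C) (linpoly b').
  have [||b' +] := gen C fullv a => //; first by rewrite capfv.
  move=> /subvP abE; suff -> : a = b' by [].
  apply/lfunP => v; apply/eqP; rewrite -subr_eq0 -opp_lfunE -add_lfunE.
  by rewrite -memv_ker abE ?memvf.
elim: s U b => [|H s IH] U b sC.
  rewrite big_nil capvf => Ub; exists 0; first by rewrite subr0.
  by rewrite linear0; exact: defideal0.
rewrite big_cons capvA => /IH[|b1 Ub1 b1I]; first by move=> x xs; rewrite sC // inE xs orbT.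
have HC : H \in C by rewrite sC // mem_head.
have [aH aHE] := hyperplane_ker (hA H (CA H HC)).
have [UH|/subvPn[u uU uH]] := boolP (U <= H)%VS.
  by exists b1 => //; rewrite -(capv_idPl UH).
have au0 : aH u != 0 by rewrite -memv_ker aHE.
pose c := (b - b1) u / aH u.
exists (b1 + c *: aH).
  apply/subvP => v vU; rewrite memv_ker.
  have : v - (aH v / aH u) *: u \in (U :&: H)%VS.
    rewrite memv_cap rpredB ?rpredZ //= -aHE memv_ker linearB linearZ /=.
    by rewrite /GRing.scale /= divfK // subrr.
  move/(subvP Ub1); rewrite memv_ker linearB linearZ /= => /eqP bv.
  rewrite opprD addrA add_lfunE opp_lfunE scale_lfunE.
  apply/eqP; rewrite -bv /GRing.scale /= /c; congr (_ - _).
  by rewrite mulrAC [in RHS]mulrC mulrA mulrAC.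
rewrite linearD linearZ /=; apply: defidealD => //.
rewrite -mul_mpolyC; apply: defidealM; exists [:: (aH, 1)]; split.
  by move=> x; rewrite inE => /eqP-> /=; rewrite aHE CA ?center_le.
by rewrite big_seq1 mulr1.
Qed.

Lemma resS_eq0 A (C : {fset {vspace V}}) f :
  is_arrangement A -> (C `<=` A)%fset ->
  resS (center C) f = 0 <-> defideal A (center C) f.
Proof.
move=> hA CA; set X := center C; split=> [f0|[r [rA ->]]]; last first.
  rewrite /resS linear_sum big_seq big1 // => u /rA[_ /subvP Xu] /=.
  rewrite rmorphM /= pullback_linpoly (_ : (_ \o _)%VF = 0) ?linear0 ?mul0r //.
  apply/lfunP => x; rewrite !lfunE /= lfunE /=; apply/eqP.
  by rewrite -memv_ker Xu ?subvsP.
pose sg (g : SV) : SV :=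
  pullback (linfun (vsproj X)) (pullback (linfun (@vsval K V X)) g).
have sgP c g g' : sg (c *: g + g') = c *: sg g + sg g' by rewrite /sg !linearP.
have sg0 : sg 0 = 0 by rewrite /sg !linear0.
have sg1 : sg 1 = 1 by rewrite /sg !rmorph1.
have sgM g g' : sg (g * g') = sg g * sg g' by rewrite /sg !rmorphM.
have sgXn g d : sg (g ^+ d) = sg g ^+ d by rewrite /sg !rmorphXn.
suff : defideal A X (f - sg f).
  by rewrite /sg -/(resS X f) f0 linear0 subr0.
elim/mpolyind: f {f0} => [|c m p _ _ IH].
  by rewrite sg0 subrr; exact: defideal0.
rewrite sgP opprD addrACA -scalerN -scalerDr.
apply: defidealD => //; rewrite -mul_mpolyC; apply: defidealM => {c p IH}.
rewrite mpolyXE_id; elim/big_ind: _ => [|x y Ix Iy|i _].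
- by rewrite sg1 subrr; exact: defideal0.
- have -> : x * y - sg (x * y) = y * (x - sg x) + sg x * (y - sg y).
    by rewrite sgM !mulrBr [y * x]mulrC [y * sg _]mulrC addrA subrK.
  by apply: defidealD; apply: defidealM.
rewrite sgXn subrXX mulrC; apply: defidealM.
rewrite -linpoly_coord /sg !pullback_linpoly -linearB.
apply: defideal_form => //.
apply/subvP => v vX; rewrite memv_ker add_lfunE opp_lfunE !comp_lfunE.
rewrite (_ : linfun vsval (linfun (vsproj X) v) = v) ?subrr //.
by rewrite lfunE /= lfunE /= vsprojK.
Qed.

End Restriction.

(* Main.v *)
Require Import Defs.
From HB Require Import structures.
From mathcomp Require Import all_boot all_order all_algebra.
From mathcomp Require Import finmap mpoly complex.
From mathcomp Require Import boolp classical_sets reals.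
From mathcomp Require Import ring.

(* At each step of the partition the derivations of degree [k] are, modulo
   [alpha_H], constant multiples of Terao's polynomial on every new hyperplane
   [H], and those of smaller degree are tangent to [H].  Evaluation at a generic
   point of the intersection of the new block shows that the matrix of these
   constants has full column rank, so after a constant base change all basis
   elements but one, [phi_H], are tangent to the new hyperplane [H]; the next
   basis is obtained by replacing each [phi_H] by [alpha_H phi_H].

   For [C] in [pi_k], removing the [phi_H] with [H] in [C] leaves derivations
   tangent to [X].  Restricting to one hyperplane after the other, the Saito
   determinant loses the factor [phi_H(alpha_H)], which is divisible by the
   forms that become redundant in the restriction; hence the determinant on [X]
   divides the defining polynomial of [A^X] and Saito's criterion applies.
   The elements [alpha_H phi_H] with [H] in [C] vanish on [X], so if [C] is chosen
   to contain the pivots of the next step, the later steps do not change the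
   restrictions of the other elements. *)

Set Implicit Arguments.
Unset Strict Implicit.
Unset Printing Implicit Defensive.

Import Order.TTheory GRing.Theory Num.Theory.

Local Open Scope ring_scope.

(** Saito's criterion enters only as a divisibility: a family of logarithmic derivations is
    controlled through the fact that its determinant divides the product of the forms. Cramer's rule
    turns this into a basis without comparing degrees, and the divisibility survives both the
    multiplication by [alpha_H] and the restriction to a hyperplane. Restricting repeatedly would
    lead to subspaces of subspaces. To stay in one ring, divisibility on X is expressed by
    polynomials on V modulo the ideal of X ([dvd_on]); only the end of the argument moves to
    [subvs_of X]. The determinant is taken in the basis of linear forms dual to the values of the
    [psi i] at the generic point. There the form of a new hyperplane H is, up to a scalar, the basis
    element with the index of [phi_H], so that restricting to H deletes a row and the column of the
    same index. The chain of restrictions starts from A_(k-1) together with pi_k minus C, where the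
    [phi_H] with H in C are still unscaled. This suffices for A^X: the forms that remain at the end
    have distinct traces on X, all of which belong to A^X. *)

Section LinearForms.
Variables (K : fieldType) (V : vectType K).
Implicit Types (U X Y H : {vspace V}) (a b u : 'Hom(V, K^o)).

Lemma form_sub U b u : (U :&: lker b <= lker u)%VS ->
  exists c : K, (U <= lker (u - c *: b))%VS.
Proof.
have [Ub|/subvPn[x xU xb]] := boolP (U <= lker b)%VS.
  by move=> Uu; exists 0; rewrite scale0r subr0 -(capv_idPl Ub).
move=> /subvP Uu; rewrite memv_ker in xb.
exists (u x / b x); apply/subvP => v vU.
have : v - (b v / b x) *: x \in (U :&: lker b)%VS.
  rewrite memv_cap rpredB ?rpredZ //= memv_ker linearB linearZ /=.
  by rewrite /GRing.scale /= divfK // subrr.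
move/Uu; rewrite !memv_ker linearB linearZ /= => /eqP uv.
rewrite add_lfunE opp_lfunE scale_lfunE.
apply/eqP; rewrite -uv /GRing.scale /=; congr (_ - _).
by rewrite mulrAC [in RHS]mulrAC; congr (_ / _); rewrite mulrC.
Qed.

Lemma form_subT b u : (lker b <= lker u)%VS -> exists c : K, u = c *: b.
Proof.
move=> bu; have [|c] := @form_sub fullv b u; first by rewrite capfv.
move=> /subvP uc; exists c; apply/lfunP => v.
apply/eqP; rewrite -subr_eq0 -opp_lfunE -add_lfunE.
by rewrite -memv_ker uc ?memvf.
Qed.

End LinearForms.

(** * Polynomial functions on subspaces *)

Section Pullbacks.
Variable K : fieldType.
Implicit Types U V W : vectType K.

(** The morphism laws are hypotheses on bare functions, so that composites such as
    [pullback g (pullback h f)] and the identity can be compared on the variables alone. *)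
Lemma rmorph_mpoly_ext n (R : comNzRingType) (f g : {mpoly K[n]} -> R)
    (c : K -> R) :
    (forall (k : K) p q, f (k *: p + q) = c k * f p + f q) ->
    (forall (k : K) p q, g (k *: p + q) = c k * g p + g q) ->
    f 0 = 0 -> g 0 = 0 ->
    f 1 = 1 -> g 1 = 1 ->
    (forall p q, f (p * q) = f p * f q) ->
    (forall p q, g (p * q) = g p * g q) ->
    (forall i, f 'X_i = g 'X_i) -> f =1 g.
Proof.
move=> fl gl f0 g0 f1 g1 fM gM fg; elim/mpolyind => [|k m p _ _ IH].
  by rewrite f0 g0.
rewrite fl gl IH; congr (_ * _ + _).
rewrite mpolyXE_id; elim/big_rec: _ => [|i x _ IHx]; first by rewrite f1 g1.
rewrite fM gM IHx; congr (_ * _); elim: (m i) => [|d IHd].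
  by rewrite !expr0 f1 g1.
by rewrite !exprS fM gM IHd fg.
Qed.

Lemma pullback_comp U V W (h : 'Hom(W, V)) (g : 'Hom(U, W)) f :
  pullback (h \o g)%VF f = pullback g (pullback h f).
Proof.
move: f; apply: (@rmorph_mpoly_ext _ _ _ _ (fun k => k%:MP)); rewrite ?linear0 ?rmorph1 //.
- by move=> k p q; rewrite linearP /= mul_mpolyC.
- by move=> k p q; rewrite !linearP /= mul_mpolyC.
- by move=> p q; rewrite rmorphM.
- by move=> p q; rewrite !rmorphM.
by move=> i; rewrite !pullbackX pullback_linpoly comp_lfunA.
Qed.

Lemma pullback1 V f : pullback (\1%VF : 'Hom(V, V)) f = f.
Proof.
move: f; apply: (@rmorph_mpoly_ext _ _ _ _ (fun k => k%:MP)); rewrite ?linear0 ?rmorph1 //.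
- by move=> k p q; rewrite linearP /= mul_mpolyC.
- by move=> k p q; rewrite mul_mpolyC.
- by move=> p q; rewrite rmorphM.
by move=> i; rewrite pullbackX comp_lfun1r linpoly_coord.
Qed.

(** The inclusion of images lets [g] factor through [h]; vanishing along a linear map therefore
    depends only on its image. *)
Lemma pullback_limg_eq0 U W V (h : 'Hom(W, V)) (g : 'Hom(U, V)) f :
  (limg g <= limg h)%VS -> pullback h f = 0 -> pullback g f = 0.
Proof.
move=> /subvP gh f0.
suff -> : g = (h \o (h^-1 \o g))%VF by rewrite pullback_comp f0 linear0.
apply/lfunP => u; rewrite !comp_lfunE /= limg_lfunVK // gh //.
by rewrite memv_img ?memvf.
Qed.

End Pullbacks.

Section OnSubspaces.
Variables (K : fieldType) (V : vectType K).
Local Notation n := (\dim {:V}).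
Local Notation S := {mpoly K[n]}.
Implicit Types (U X Y H : {vspace V}) (a b u : 'Hom(V, K^o)) (f g : S).

Definition incl X : 'Hom(subvs_of X, V) := linfun (@vsval K V X).

Lemma inclE X (x : subvs_of X) : incl X x = vsval x.
Proof. by rewrite lfunE. Qed.

Lemma limg_incl X : limg (incl X) = X.
Proof.
apply/eqP; rewrite eqEsubv; apply/andP; split; apply/subvP => v.
  by case/memv_imgP=> x _ ->; rewrite inclE subvsP.
move=> vX; apply/memv_imgP; exists (vsproj X v); rewrite ?memvf //.
by rewrite inclE vsprojK.
Qed.

Lemma resSD X f g : resS X (f + g) = resS X f + resS X g.
Proof. exact: raddfD. Qed.
Lemma resSB X f g : resS X (f - g) = resS X f - resS X g.
Proof. exact: raddfB. Qed.
Lemma resSM X f g : resS X (f * g) = resS X f * resS X g.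
Proof. exact: rmorphM. Qed.
Lemma resSZ X c f : resS X (c *: f) = c *: resS X f.
Proof. exact: linearZ. Qed.
Lemma resS0 X : resS X (0 : S) = 0.
Proof. exact: raddf0. Qed.
Lemma resS1 X : resS X (1 : S) = 1.
Proof. exact: rmorph1. Qed.
Lemma resS_sum X (I : Type) (r : seq I) (P : pred I) (F : I -> S) :
  resS X (\sum_(i <- r | P i) F i) = \sum_(i <- r | P i) resS X (F i).
Proof. exact: raddf_sum. Qed.

Lemma resS_sub X Y f : (X <= Y)%VS -> resS Y f = 0 -> resS X f = 0.
Proof.
move=> XY; apply: pullback_limg_eq0.
by rewrite (limg_incl X) (limg_incl Y).
Qed.

Lemma resS_subE X Y f g :
  (X <= Y)%VS -> resS Y f = resS Y g -> resS X f = resS X g.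
Proof.
move=> XY fg; apply/eqP; rewrite -subr_eq0 -resSB; apply/eqP.
by apply: resS_sub XY _; rewrite resSB fg subrr.
Qed.

Lemma linpolyE_coef a (i : 'I_n) : a (vbasis {:V})`_i = meval
   (fun j => ((j == i)%:R : K)) (linpoly a).
Proof.
rewrite /linpoly raddf_sum /= (bigD1 i) //= big1 => [|j ji]; rewrite mevalZ mevalXU.
  by rewrite eqxx mulr1 addr0.
by rewrite (negPf ji) mulr0.
Qed.

Lemma linpoly_inj : injective (@linpoly K V).
Proof.
move=> a b ab; apply/lfunP => x.
rewrite (coord_vbasis (memvf x)) !linear_sum; apply: eq_bigr => i _.
by rewrite !linearZ /= !linpolyE_coef ab.
Qed.

Lemma linpoly_eq0 a : (linpoly a == 0) = (a == 0).
Proof. by rewrite -(inj_eq linpoly_inj) linear0. Qed.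

Lemma linpolyB a b : linpoly (a - b) = linpoly a - linpoly b.
Proof. exact: raddfB. Qed.

Lemma linpolyZ (c : K) a : linpoly (c *: a) = c *: linpoly a.
Proof. exact: linearZ. Qed.

Lemma resS_linpoly X a : resS X (linpoly a) = linpoly (a \o incl X)%VF.
Proof. exact: pullback_linpoly. Qed.

End OnSubspaces.
Arguments incl {K V} X.

Lemma resS_linpoly_eq0 (K : fieldType) (V : vectType K) (X : {vspace V})
  (a : 'Hom(V, K^o)) : (resS X (linpoly a) == 0) = (X <= lker a)%VS.
Proof.
rewrite resS_linpoly linpoly_eq0; apply/eqP/subvP => [aX v vX|aX].
  move/lfunP: aX => /(_ (vsproj X v)); rewrite comp_lfunE inclE vsprojK //.
  by rewrite memv_ker => ->; rewrite zero_lfunE.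
apply/lfunP => x; rewrite comp_lfunE inclE zero_lfunE; apply/eqP.
by rewrite -memv_ker aX ?subvsP.
Qed.

Section Ideal.
Variables (K : fieldType) (V : vectType K).
Local Notation n := (\dim {:V}).
Local Notation S := {mpoly K[n]}.
Implicit Types (U X Y H : {vspace V}) (a b : 'Hom(V, K^o)) (f g : S).

Definition liftS X (p : {mpoly K[\dim {: subvs_of X}]}) : S :=
  pullback (linfun (vsproj X)) p.

Lemma liftSK X (p : {mpoly K[\dim {: subvs_of X}]}) : resS X (liftS p) = p.
Proof.
rewrite /resS /liftS -pullback_comp (_ : (_ \o _)%VF = \1%VF) ?pullback1 //.
by apply/lfunP => x; rewrite comp_lfunE id_lfunE lfunE /= lfunE /= vsvalK.
Qed.

(** [f] is compared with [liftS (resS X f)], its composition with the projection of [V] onto [X]: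
    the difference lies in the ideal because it does for each variable. Here [X] is any subspace,
    and every form vanishing on it may serve as a generator. *)
Lemma resS_ideal X f : resS X f = 0 ->
  exists r : seq ('Hom(V, K^o) * S),
    (forall u, u \in r -> (X <= lker u.1)%VS) /\
    f = \sum_(u <- r) linpoly u.1 * u.2.
Proof.
pose I g := exists r : seq ('Hom(V, K^o) * S),
    (forall u, u \in r -> (X <= lker u.1)%VS) /\
    g = \sum_(u <- r) linpoly u.1 * u.2.
have I0 : I 0 by exists [::]; rewrite big_nil.
have ID g h : I g -> I h -> I (g + h).
  move=> [r [rA ->]] [t [tA ->]]; exists (r ++ t); split; last by rewrite big_cat.
  by move=> u; rewrite mem_cat => /orP[/rA|/tA].
have IM g h : I g -> I (h * g).
  move=> [r [rA ->]]; exists [seq (u.1, h * u.2) | u <- r]; split.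
    by move=> _ /mapP[u /rA uA ->].
  by rewrite big_map mulr_sumr; apply: eq_bigr => u _; rewrite mulrCA.
pose sg g := liftS (resS X g).
have sgP c g g' : sg (c *: g + g') = c *: sg g + sg g' by rewrite /sg /resS /liftS !linearP.
have sg0 : sg 0 = 0 by rewrite /sg /resS /liftS !linear0.
have sg1 : sg 1 = 1 by rewrite /sg /resS /liftS !rmorph1.
have sgM g g' : sg (g * g') = sg g * sg g' by rewrite /sg /resS /liftS !rmorphM.
have sgXn g d : sg (g ^+ d) = sg g ^+ d by rewrite /sg /resS /liftS !rmorphXn.
move=> f0; suff : I (f - sg f) by rewrite /sg f0 /liftS linear0 subr0.
elim/mpolyind: f {f0} => [|c m p _ _ IH]; first by rewrite sg0 subrr.
rewrite sgP opprD addrACA -scalerN -scalerDr.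
apply: (ID) => //; rewrite -mul_mpolyC; apply: (IM) => {c p IH}.
rewrite mpolyXE_id; elim/big_ind: _ => [|x y Ix Iy|i _].
- by rewrite sg1 subrr.
- have -> : x * y - sg (x * y) = y * (x - sg x) + sg x * (y - sg y).
    by rewrite sgM !mulrBr [y * x]mulrC [y * sg _]mulrC addrA subrK.
  exact: ID (IM _ _ Ix) (IM _ _ Iy).
rewrite sgXn subrXX mulrC; apply: IM.
rewrite -linpoly_coord /sg resS_linpoly /liftS pullback_linpoly -linpolyB.
set a := (X in linpoly X); exists [:: (a, 1)]; rewrite big_seq1 mulr1; split=> //.
move=> u; rewrite inE => /eqP -> /=; apply/subvP => v vX.
rewrite memv_ker /a add_lfunE opp_lfunE !comp_lfunE.
by rewrite [linfun (vsproj X) v]lfunE /= inclE vsprojK // subrr.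
Qed.

Definition dvd_on X f g := exists h, resS X g = resS X (f * h).

(** By [form_sub], each generator of the ideal of [X :&: lker b] is on [X] a constant multiple of
    [b]. *)
Lemma dvd_on_ker X b f : resS (X :&: lker b) f = 0 -> dvd_on X (linpoly b) f.
Proof.
move=> /resS_ideal[r [rX ->]]; elim: r rX => [_|u r IH rX].
  by exists 0; rewrite mulr0 big_nil.
have [|h hE] := IH; first by move=> x xr; apply: rX; rewrite inE xr orbT.
have [c uc] := form_sub (rX u (mem_head _ _)).
have {}uc : resS X (linpoly u.1) = c *: resS X (linpoly b).
  apply/eqP; rewrite -resSZ -subr_eq0 -resSB.
  by rewrite -linpolyZ -linpolyB resS_linpoly_eq0.
exists (c *: u.2 + h); rewrite big_cons resSD hE resSM uc !resSM resSD resSZ mulrDr.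
by rewrite -!mul_mpolyC; congr (_ + _); rewrite mulrCA mulrA.
Qed.

(** [subvs_of fullv] is a type different from [V], so restriction to the whole space is not
    literally the identity. *)
Lemma resS_fullv f : resS fullv f = 0 -> f = 0.
Proof.
move=> f0; rewrite -[f]pullback1; apply: pullback_limg_eq0 f0.
by rewrite (limg_incl fullv) subvf.
Qed.

Lemma resS_fullvI f g : resS fullv f = resS fullv g -> f = g.
Proof.
by move=> fg; apply/eqP; rewrite -subr_eq0; apply/eqP/resS_fullv; rewrite resSB fg subrr.
Qed.

Lemma dvd_on_fullv f g : dvd_on fullv f g -> exists h, g = f * h.
Proof. by case=> h /resS_fullvI ->; exists h. Qed.

Definition ev (v : V) f : K := f.@[fun i => coord (vbasis {:V}) i v].

Lemma ev_linpoly v a : ev v (linpoly a) = a v.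
Proof.
rewrite [in RHS](coord_vbasis (memvf v)) linear_sum /ev /linpoly raddf_sum /=.
by apply: eq_bigr => i _; rewrite mevalZ mevalXU linearZ /= mulrC.
Qed.

Lemma ev_on X v f : v \in X -> resS X f = 0 -> ev v f = 0.
Proof.
move=> vX /resS_ideal[r [rX ->]]; rewrite /ev raddf_sum big_seq big1 // => u.
move=> /rX/subvP/(_ _ vX); rewrite memv_ker /= mevalM -/(ev _ _) ev_linpoly.
by move=> /eqP->; rewrite mul0r.
Qed.

Lemma ev_onE X v f g : v \in X -> resS X f = resS X g -> ev v f = ev v g.
Proof.
move=> vX fg; apply/eqP; rewrite -subr_eq0 -raddfB; apply/eqP.
by apply: (ev_on vX); rewrite resSB fg subrr.
Qed.

End Ideal.

(** * Divisibility modulo the ideal of a subspace *)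

Section Divisibility.
Variables (K : fieldType) (V : vectType K).
Local Notation n := (\dim {:V}).
Local Notation S := {mpoly K[n]}.
Implicit Types (U X Y H : {vspace V}) (a b c : 'Hom(V, K^o)) (f g : S).
Implicit Types (s t : seq 'Hom(V, K^o)).

Definition prodlin t : S := \prod_(a <- t) linpoly a.

Lemma prodlin_cons a t : prodlin (a :: t) = linpoly a * prodlin t.
Proof. exact: big_cons. Qed.

Lemma prodlin_cat s t : prodlin (s ++ t) = prodlin s * prodlin t.
Proof. exact: big_cat. Qed.

Lemma resS_prodlin_neq0 X t :
  (forall a, a \in t -> ~~ (X <= lker a)%VS) -> resS X (prodlin t) != 0.
Proof.
elim: t => [_|a t IH nv]; first by rewrite /prodlin big_nil resS1 oner_neq0.
rewrite prodlin_cons resSM mulf_neq0 ?resS_linpoly_eq0 ?nv ?mem_head //.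
by apply: IH => b bt; rewrite nv // inE bt orbT.
Qed.

Lemma dvd_onW X Y f g : (X <= Y)%VS -> dvd_on Y f g -> dvd_on X f g.
Proof. by move=> XY [h /(resS_subE XY) fg]; exists h. Qed.

Lemma dvd_on_eqr X f g g' : resS X g = resS X g' -> dvd_on X f g -> dvd_on X f g'.
Proof. by move=> gg [h fh]; exists h; rewrite -gg. Qed.

Lemma dvd_on_cancel X f g h : resS X f != 0 ->
  dvd_on X (f * g) (f * h) -> dvd_on X g h.
Proof.
move=> f0 [k]; rewrite -mulrA resSM [in RHS]resSM => /(mulfI f0) gh.
by exists k.
Qed.

(** The quotient by [a] of the functions on [X] is the polynomial ring of [X :&: lker a], an
    integral domain. *)
Lemma dvd_on_prime X a f g : dvd_on X (linpoly a) (f * g) ->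
  dvd_on X (linpoly a) f \/ dvd_on X (linpoly a) g.
Proof.
move=> [h fg]; have : resS (X :&: lker a) (f * g) = 0.
  rewrite (resS_subE (capvSl _ _) fg) resSM.
  have /eqP-> : resS (X :&: lker a) (linpoly a) == 0.
    by rewrite resS_linpoly_eq0 capvSr.
  by rewrite mul0r.
move/eqP; rewrite resSM mulf_eq0.
by case/orP=> /eqP/dvd_on_ker; [left|right].
Qed.

Lemma dvd_on_trace X a b : dvd_on X (linpoly a) (linpoly b) ->
  ~~ (X <= lker b)%VS -> (X :&: lker a = X :&: lker b)%VS.
Proof.
move=> [h ab] nvb; have : (X :&: lker a <= lker b)%VS.
  rewrite -resS_linpoly_eq0 (resS_subE (capvSl _ _) ab) resSM.
  have /eqP-> : resS (X :&: lker a) (linpoly a) == 0.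
    by rewrite resS_linpoly_eq0 capvSr.
  by rewrite mul0r.
move/form_sub=> [c /subvP bc].
have bca v : v \in X -> b v = c * a v.
  move/bc; rewrite memv_ker add_lfunE opp_lfunE scale_lfunE subr_eq0.
  by move/eqP.
have c0 : c != 0.
  apply: contraNneq nvb => c0; apply/subvP => v /bca.
  by rewrite c0 mul0r memv_ker => ->.
apply/vspaceP => v; rewrite !memv_cap; apply: andb_id2l => /bca.
by rewrite !memv_ker => ->; rewrite mulf_eq0 (negPf c0).
Qed.

(** Forms with different traces on [X] are non-associate primes there, so [a] has to divide the
    remaining factor. *)
Lemma dvd_on_gauss1 X a t f : ~~ (X <= lker a)%VS ->
  (forall b, b \in t -> ~~ (X <= lker b)%VS) ->
  (forall b, b \in t -> (X :&: lker a)%VS != (X :&: lker b)%VS) ->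
  dvd_on X (linpoly a) (prodlin t * f) -> dvd_on X (linpoly a) f.
Proof.
move=> nva; elim: t => [|b t IH] nv ab.
  by rewrite /prodlin big_nil mul1r.
rewrite prodlin_cons -mulrA => /dvd_on_prime[/dvd_on_trace|].
  by move=> /(_ (nv _ (mem_head _ _))) /eqP; rewrite (negPf (ab _ (mem_head _ _))).
by apply: IH => c ct; rewrite ?nv ?ab // inE ct orbT.
Qed.

Lemma dvd_on_gauss X t s f :
  (forall b, b \in t -> ~~ (X <= lker b)%VS) ->
  (forall b, b \in s -> ~~ (X <= lker b)%VS) ->
  (forall a b, a \in t -> b \in s -> (X :&: lker a)%VS != (X :&: lker b)%VS) ->
  dvd_on X (prodlin t) (prodlin s * f) -> dvd_on X (prodlin t) f.
Proof.
elim: t f => [|a t IH] f nvt nvs ts.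
  by move=> _; exists f; rewrite /prodlin big_nil mul1r.
rewrite prodlin_cons => -[h fE].
have nva : ~~ (X <= lker a)%VS by rewrite nvt ?mem_head.
have [k kE] : dvd_on X (linpoly a) f.
  apply: (@dvd_on_gauss1 _ _ s) => //; first by move=> b; apply: ts; rewrite mem_head.
  by exists (prodlin t * h); rewrite fE mulrA.
have : dvd_on X (prodlin t) k.
  apply: IH => // [b bt|b c bt cs|]; rewrite ?nvt ?ts //; try by rewrite inE bt orbT.
  apply: (@dvd_on_cancel _ (linpoly a)); first by rewrite resS_linpoly_eq0.
  by exists h; rewrite -fE mulrCA !resSM kE !resSM.
by case=> l lE; exists l; rewrite kE -mulrA [in RHS]resSM -lE resSM.
Qed.

Lemma prodlin_dvd_on X t f :
  (forall b, b \in t -> ~~ (X <= lker b)%VS) ->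
  uniq [seq (X :&: lker a)%VS | a <- t] ->
  (forall a, a \in t -> dvd_on X (linpoly a) f) -> dvd_on X (prodlin t) f.
Proof.
elim: t => [|a t IH] nv; first by exists f; rewrite /prodlin big_nil mul1r.
move=> /= /andP[at' ut] dv.
have [|//||h hE] := IH; first by move=> b bt; rewrite nv // inE bt orbT.
  by move=> b bt; apply: dv; rewrite inE bt orbT.
have [k kE] : dvd_on X (linpoly a) h.
  apply: (@dvd_on_gauss1 _ _ t) => [|b bt|b bt|]; rewrite ?nv ?mem_head //.
  - by rewrite inE bt orbT.
  - by apply: contraNneq at' => ->; apply: map_f.
  by apply: dvd_on_eqr hE _; apply: dv; rewrite mem_head.
exists k; rewrite hE prodlin_cons mulrAC [in RHS]resSM -kE [in RHS]mulrC.
by rewrite resSM.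
Qed.

(** [s1] keeps one form for each trace on [X] and [rest] collects the redundant ones. As different
    traces are coprime, divisibility by [rest] reduces to one class at a time: for its
    representative [c], the product [t] of the other members. *)
Lemma split_traces X s :
  uniq s -> (forall b, b \in s -> ~~ (X <= lker b)%VS) ->
  exists s1 rest, [/\ perm_eq s (s1 ++ rest),
    uniq [seq (X :&: lker a)%VS | a <- s1]
  & forall f,
    (forall c t, c \in s -> uniq t -> {subset t <= s} -> c \notin t ->
       (forall a, a \in t -> (X :&: lker a = X :&: lker c)%VS) ->
       dvd_on X (prodlin t) f) ->
    dvd_on X (prodlin rest) f].
Proof.
have [m] := ubnP (size s); elim: m s => // m IH [_ _ _|c s /ltnSE sm].
  exists [::], [::]; split=> // f _; exists f.
  by rewrite /prodlin big_nil mul1r.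
move=> /= /andP[cs us] nv.
pose same := [pred a : 'Hom(V, K^o) | (X :&: lker a == X :&: lker c)%VS].
have [|||s1 [rest [perm u1 dv]]] := IH (filter (predC same) s).
- by rewrite (leq_ltn_trans _ sm) // size_filter count_size.
- exact: filter_uniq.
- by move=> b; rewrite mem_filter => /andP[_ bs]; rewrite nv // inE bs orbT.
have sub1 b : b \in s1 ++ rest -> b \in s /\ ~~ same b.
  by rewrite -(perm_mem perm) mem_filter => /andP[].
exists (c :: s1), (filter same s ++ rest); split.
- rewrite cat_cons perm_cons.
  apply: (perm_trans (y := filter same s ++ filter (predC same) s)).
    by rewrite perm_sym; apply: permEl; apply: perm_filterC.
  by rewrite perm_sym perm_catCA perm_cat2l perm_sym.
- rewrite /= u1 andbT; apply/mapP => -[b bs1 cb].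
  have [|_ ] := sub1 b; first by rewrite mem_cat bs1.
  by rewrite /= cb eqxx.
move=> f fdv; rewrite prodlin_cat.
have [h hE] : dvd_on X (prodlin (filter same s)) f.
  apply: (fdv c).
  - exact: mem_head.
  - exact: filter_uniq.
  - by move=> b; rewrite mem_filter => /andP[_ bs]; rewrite inE bs orbT.
  - by rewrite mem_filter (negPf cs) andbF.
  by move=> b; rewrite mem_filter => /andP[/eqP].
have [k kE] : dvd_on X (prodlin rest) h.
  apply: (@dvd_on_gauss _ _ (filter same s)).
  - move=> b br; have [|bs _] := sub1 b; first by rewrite mem_cat br orbT.
    by rewrite nv // inE bs orbT.
  - by move=> b; rewrite mem_filter => /andP[_ bs]; rewrite nv // inE bs orbT.
  - move=> a b ar; have [|_ na] := sub1 a; first by rewrite mem_cat ar orbT.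
    rewrite mem_filter => /andP[/eqP -> _]; exact: na.
  apply: dvd_on_eqr hE _; apply: dv => d t ds ut ts dt tE; apply: (fdv d) => //.
    by move: ds; rewrite mem_filter => /andP[_ ds]; rewrite inE ds orbT.
  by move=> b /ts; rewrite mem_filter => /andP[_ bs]; rewrite inE bs orbT.
by exists k; rewrite hE resSM kE -resSM mulrA.
Qed.

End Divisibility.

(** * Derivations and tangency *)

Section Derivations.
Variables (K : fieldType) (V : vectType K).
Local Notation n := (\dim {:V}).
Local Notation S := {mpoly K[n]}.
Implicit Types (U X Y H : {vspace V}) (a b c : 'Hom(V, K^o)) (f g : S).
Implicit Types (s t : seq 'Hom(V, K^o)) (theta eta : S -> S).

Section Der.
Variables (theta : S -> S) (dth : is_derivation theta).

Lemma derP (c : K) f g : theta (c *: f + g) = c *: theta f + theta g.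
Proof. by case: dth => + _; apply. Qed.
Lemma derM f g : theta (f * g) = theta f * g + f * theta g.
Proof. by case: dth => _; apply. Qed.
Lemma derD f g : theta (f + g) = theta f + theta g.
Proof. by rewrite -[f]scale1r derP !scale1r. Qed.
Lemma der0 : theta 0 = 0.
Proof. by apply: (addrI (theta 0)); rewrite -derD !addr0. Qed.
Lemma derZ (c : K) f : theta (c *: f) = c *: theta f.
Proof. by rewrite -[c *: f]addr0 derP der0 addr0. Qed.
Lemma derN f : theta (- f) = - theta f.
Proof. by rewrite -scaleN1r derZ scaleN1r. Qed.
Lemma derB f g : theta (f - g) = theta f - theta g.
Proof. by rewrite derD derN. Qed.
Lemma der_sum (I : Type) (r : seq I) (P : pred I) (F : I -> S) :
  theta (\sum_(i <- r | P i) F i) = \sum_(i <- r | P i) theta (F i).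
Proof. exact: (big_morph theta derD der0). Qed.
Lemma der1 : theta 1 = 0.
Proof.
by apply: (addrI (theta 1)); have := derM 1 1; rewrite !mulr1 mul1r addr0 => <-.
Qed.
Lemma der_linpoly a :
  theta (linpoly a) = \sum_(i < n) a (vbasis {:V})`_i *: theta 'X_i.
Proof. by rewrite /linpoly der_sum; apply: eq_bigr => i _; rewrite derZ. Qed.

End Der.

Lemma der_eq0 theta : is_derivation theta ->
  (forall i, theta 'X_i = 0) -> forall f, theta f = 0.
Proof.
move=> dth th0; elim/mpolyind => [|k m p _ _ IH]; first exact: der0.
rewrite derP // IH addr0 mpolyXE_id.
elim/big_ind: _ => [|f g f0 g0|i _]; first by rewrite der1 // scaler0.
  have [k0|k0] := eqVneq k 0; first by rewrite k0 scale0r.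
  move/eqP: f0; rewrite scaler_eq0 (negPf k0) => /eqP f0.
  move/eqP: g0; rewrite scaler_eq0 (negPf k0) => /eqP g0.
  by rewrite derM // f0 g0 mul0r mulr0 addr0 scaler0.
suff -> : theta ('X_i ^+ m i) = 0 by rewrite scaler0.
elim: (m i) => [|d IHd]; first by rewrite expr0 der1.
by rewrite exprS derM // th0 IHd mul0r mulr0 addr0.
Qed.

Lemma is_derivation_comb (I : finType) (P : pred I) (c : I -> S) (theta : I -> S -> S) :
  (forall i, is_derivation (theta i)) ->
  is_derivation (fun f => \sum_(i | P i) c i * theta i f).
Proof.
move=> dth; split=> [k f g|f g].
  rewrite scaler_sumr -big_split; apply: eq_bigr => i _ /=.
  by rewrite derP // mulrDr scalerAr.
rewrite mulr_suml mulr_sumr -big_split; apply: eq_bigr => i _ /=.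
by rewrite derM // mulrDr mulrA [in RHS]mulrCA.
Qed.

Lemma is_derivation_sub theta eta : is_derivation theta -> is_derivation eta ->
  is_derivation (fun f => theta f - eta f).
Proof.
move=> dt de; split=> [k f g|f g].
  by rewrite (derP dt) (derP de) scalerBr opprD addrACA.
by rewrite (derM dt) (derM de) opprD addrACA mulrBl mulrBr.
Qed.

Lemma der_ext theta eta : is_derivation theta -> is_derivation eta ->
  (forall i, theta 'X_i = eta 'X_i) -> theta =1 eta.
Proof.
move=> dt de te f; apply/eqP; rewrite -subr_eq0; apply/eqP.
apply: (@der_eq0 (fun f => theta f - eta f)); first exact: is_derivation_sub.
by move=> i; rewrite te subrr.
Qed.

(** The forms vanishing on an intersection of kernels are spanned by the given ones; an induction
    principle avoids handling the coefficients. *)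
Lemma form_cap_ind (P : 'Hom(V, K^o) -> Prop) (I : eqType) (r : seq I)
    (F : I -> 'Hom(V, K^o)) :
  P 0 -> (forall (k : K) a b, P a -> P b -> P (k *: a + b)) ->
  (forall i, i \in r -> P (F i)) ->
  forall a, (\bigcap_(i <- r) lker (F i) <= lker a)%VS -> P a.
Proof.
move=> P0 PD PF a aF.
suff [b /subvP ab Pb] : exists2 b, (fullv <= lker (a - b))%VS & P b.
  suff -> : a = b by [].
  apply/lfunP => v; apply/eqP; rewrite -subr_eq0 -opp_lfunE -add_lfunE.
  by rewrite -memv_ker ab ?memvf.
have gen U : (U :&: \bigcap_(i <- r) lker (F i) <= lker a)%VS ->
    exists2 b, (U <= lker (a - b))%VS & P b.
  elim: r U {aF} PF => [|i r IH] U PF.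
    by rewrite big_nil capvf => Ua; exists 0; rewrite ?subr0.
  rewrite big_cons capvA => /IH[|b].
    by move=> j jr; apply: PF; rewrite inE jr orbT.
  move=> /form_sub[k Uk] Pb; exists (k *: F i + b); last first.
    by apply: PD => //; apply: PF; rewrite mem_head.
  by rewrite [_ + b]addrC opprD addrA.
by apply: gen; rewrite capfv.
Qed.

(** The ideal of the intersection is generated by the [F i], and by the Leibniz rule only generators
    have to be checked. *)
Lemma tangent_cap theta (I : eqType) (r : seq I) (F : I -> 'Hom(V, K^o)) :
  is_derivation theta ->
  (forall i, i \in r -> resS (lker (F i)) (theta (linpoly (F i))) = 0) ->
  forall f, resS (\bigcap_(i <- r) lker (F i))%VS f = 0 ->
    resS (\bigcap_(i <- r) lker (F i))%VS (theta f) = 0.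
Proof.
move=> dth tF f /resS_ideal[t [tX ->]]; set X := (X in resS X).
rewrite der_sum // resS_sum; apply: big1_seq => u /= /tX Xu.
rewrite derM // resSD !resSM.
have /eqP -> : resS X (linpoly u.1) == 0 by rewrite resS_linpoly_eq0.
rewrite mul0r addr0 (_ : resS X (theta _) = 0) ?mul0r // {tX f}.
move: u.1 Xu; apply: form_cap_ind => [|k a b a0 b0|i ir].
- by rewrite linear0 der0 // resS0.
- by rewrite linearP derP // resSD resSZ a0 b0 scaler0 addr0.
apply: resS_sub (tF i ir); rewrite /X (big_rem i) //=; exact: capvSl.
Qed.

Lemma dvd_linpolyP a f :
  resS (lker a) f = 0 <-> exists g, f = linpoly a * g.
Proof.
split=> [f0|[g ->]].
  by apply: dvd_on_fullv; apply: dvd_on_ker; rewrite capfv.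
by rewrite resSM (_ : resS _ _ = 0) ?mul0r //; apply/eqP; rewrite resS_linpoly_eq0.
Qed.

Lemma logderP (A : {fset {vspace V}}) theta :
  logder A theta <-> is_derivation theta /\
    forall a, lker a \in A -> resS (lker a) (theta (linpoly a)) = 0.
Proof.
split=> -[dth tA]; split=> //.
  by move=> a aA; apply/dvd_linpolyP; apply: tA aA _.
by move=> H a HA aH; apply/dvd_linpolyP/tA; rewrite aH.
Qed.

Lemma logder_comb (A : {fset {vspace V}}) (I : finType) (P : pred I) (c : I -> S)
    (theta : I -> S -> S) : (forall i, logder A (theta i)) ->
  logder A (fun f => \sum_(i | P i) c i * theta i f).
Proof.
move=> lth; apply/logderP; split.
  by apply: is_derivation_comb => i; case: (lth i).
move=> a aA; rewrite resS_sum big1 // => i _; rewrite resSM.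
by have /logderP[_ /(_ _ aA)->] := lth i; rewrite mulr0.
Qed.

(* With [b = k1 c + k2 a] on [Y] and [theta c = c g], the polynomial
   [theta a - a g] is divisible by [b] on [Y], independently of [b]. *)
Lemma dvd_on_group Y a theta s c t :
  is_derivation theta -> (forall f, resS Y f = 0 -> resS Y (theta f) = 0) ->
  (forall b, b \in s -> exists g, theta (linpoly b) = linpoly b * g) ->
  (forall b, b \in s -> ~~ (Y :&: lker a <= lker b)%VS) ->
  {in s &, injective (fun b => Y :&: lker b)%VS} ->
  c \in s -> uniq t -> {subset t <= s} -> c \notin t ->
  (forall b, b \in t -> (Y :&: lker a :&: lker b = Y :&: lker a :&: lker c)%VS) ->
  dvd_on (Y :&: lker a) (prodlin t) (theta (linpoly a)).
Proof.
move=> dth tY ts nv inj cs ut st ct bc.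
have nvY b : b \in s -> ~~ (Y <= lker b)%VS.
  by move=> /nv; apply: contra; apply: subv_trans (capvSl _ _).
have [g gE] := ts c cs.
have aX : resS (Y :&: lker a) (linpoly a) = 0.
  by apply/eqP; rewrite resS_linpoly_eq0 capvSr.
apply: (@dvd_on_eqr _ _ _ _ (theta (linpoly a) - linpoly a * g)).
  by rewrite resSB resSM aX mul0r subr0.
apply: (dvd_onW (capvSl _ _)); apply: prodlin_dvd_on.
- by move=> b /st/nvY.
- by rewrite map_inj_in_uniq // => b b' /st bs /st; apply: inj.
move=> b bt; have bs := st b bt; have [g' g'E] := ts b bs.
have : (Y :&: lker c :&: lker a <= lker b)%VS.
  by rewrite -capvA [(lker c :&: _)%VS]capvC capvA -(bc b bt) capvSr.
move/form_sub=> [k2 /form_sub[k1 bE]].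
have {}bE : resS Y (linpoly b - k2 *: linpoly a - k1 *: linpoly c) = 0.
  have -> : linpoly b - k2 *: linpoly a - k1 *: linpoly c =
      linpoly (b - k2 *: a - k1 *: c) by rewrite !linpolyB !linpolyZ.
  by apply/eqP; rewrite resS_linpoly_eq0.
(* Otherwise [b] and [c] would have the same trace on [Y], against injectivity. *)
have k20 : k2 != 0.
  apply: contraNneq ct => k0; suff -> : c = b by [].
  apply: inj => //; apply: dvd_on_trace (nvY b bs).
  exists (k1%:MP); apply/eqP; rewrite -subr_eq0 -resSB mulrC mul_mpolyC.
  by move: bE; rewrite k0 scale0r subr0 => ->.
have thbE := tY _ bE; rewrite !(derB dth) !(derZ dth) gE g'E in thbE.
(* Subtracting [g] times the relation [b = k2 a + k1 c] from its image under [theta] leaves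
   [k2 (theta a - a g) = b (g' - g)] on [Y]. *)
exists (k2^-1 *: (g' - g)); apply/eqP; rewrite -subr_eq0 -resSB; apply/eqP.
apply: (@scalerI _ _ k2) => //; rewrite scaler0.
rewrite -resSZ.
set lhs := (X in resS Y X).
have -> : lhs = - (linpoly b * g' - k2 *: theta (linpoly a) - k1 *: (linpoly c * g))
   + (linpoly b - k2 *: linpoly a - k1 *: linpoly c) * g.
  rewrite /lhs -scalerAr scalerBr scalerA divff // scale1r scalerBr.
  by rewrite -!mul_mpolyC; ring.
by rewrite resSD resSM bE mul0r addr0 -scaleN1r resSZ thbE scaler0.
Qed.

End Derivations.

HB.instance Definition _ (K : fieldType) (V : vectType K) (X : {vspace V}) :=
  GRing.LRMorphism.copy (@resS K V X) (pullback (linfun (@vsval K V X))).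

Lemma uniq_map_injin (T1 T2 : eqType) (f : T1 -> T2) (s : seq T1) :
  uniq (map f s) -> {in s &, injective f}.
Proof.
elim: s => // a s IH /= /andP[fa us] x y; rewrite !inE.
move=> /orP[/eqP->|xs] /orP[/eqP->|ys] // fxy; last exact: IH.
  by case/mapP: fa; exists y.
by case/mapP: fa; exists x.
Qed.

(** * Determinants and Saito's criterion *)

Section Matrices.
Variables (R : comNzRingType) (m : nat).
Implicit Types (A B : 'M[R]_m).

Lemma eq_cofactor_row A B i j :
  (forall k l, k != i -> A k l = B k l) -> cofactor A i j = cofactor B i j.
Proof.
move=> AB; congr (_ * \det _); apply/matrixP => k l; rewrite !mxE AB //.
by rewrite eq_sym neq_lift.
Qed.

(** Both determinants are expanded along column [i], whose cofactors do not see row [i]. This strips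
    one index from a masked determinant. *)
Lemma det_single_col A B i :
  (forall k l, k != i -> A k l = B k l) -> (forall k, k != i -> A k i = 0) ->
  B i i = 1 -> \det A = A i i * \det B.
Proof.
move=> AB A0 Bii; rewrite (expand_det_col A i) (expand_det_col B i).
rewrite (bigD1 i) //= big1 ?addr0 => [|k ki]; last by rewrite A0 ?mul0r.
rewrite [in RHS](bigD1 i) //= big1 ?addr0 => [|k ki]; last by rewrite -AB ?A0 ?mul0r.
by rewrite Bii mul1r (eq_cofactor_row _ AB).
Qed.

Definition subst_row A i (r : 'rV[R]_m) : 'M[R]_m :=
  \matrix_(k, l) if k == i then r 0 l else A k l.

Lemma cramer_row A i (r : 'rV[R]_m) : (r *m \adj A) 0 i = \det (subst_row A i r).
Proof.
rewrite mxE (expand_det_row _ i); apply: eq_bigr => l _; rewrite !mxE eqxx.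
congr (_ * _); apply: eq_cofactor_row => k l' ki.
by rewrite mxE (negPf ki).
Qed.

Definition mask_rows (J : pred 'I_m) A : 'M[R]_m :=
  \matrix_(i, l) if J i then (i == l)%:R else A i l.

End Matrices.

Lemma det_ker0 (R : idomainType) m (A : 'M[R]_m) (w : 'cV[R]_m) :
  w != 0 -> A *m w = 0 -> \det A = 0.
Proof.
move=> w0 Aw; rewrite -det_tr; apply/eqP/det0P; exists w^T.
  by rewrite trmx_eq0.
by rewrite -trmx_mul Aw trmx0.
Qed.

Definition der_mx (K : fieldType) (V : vectType K) m
    (theta : 'I_m -> {mpoly K[\dim {:V}]} -> {mpoly K[\dim {:V}]})
    (lam : 'I_m -> 'Hom(V, K^o)) : 'M[{mpoly K[\dim {:V}]}]_m :=
  \matrix_(i, l) theta i (linpoly (lam l)).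

Section Saito.
Variables (K : fieldType) (W : vectType K).
Local Notation S := {mpoly K[\dim {:W}]}.
Variables (B : {fset {vspace W}}) (m : nat) (J : pred 'I_m).
Variables (eta : 'I_m -> S -> S) (lam : 'I_m -> 'Hom(W, K^o)).
Hypothesis etaB : forall i, ~~ J i -> logder B (eta i).
Hypothesis lamJ : forall l, J l -> lam l = 0.
Hypothesis lam_span : forall a, exists w : 'I_m -> K, a = \sum_l w l *: lam l.
Let N := mask_rows J (der_mx eta lam).
Hypothesis detN0 : \det N != 0.
Hypothesis detN_dvd : forall f : S,
  (forall a : 'Hom(W, K^o), a != 0 -> lker a \in B -> resS (lker a) f = 0) ->
  exists g, f = \det N * g.

Lemma saito_free (c : 'I_m -> S) :
  (forall p, \sum_(i | ~~ J i) c i * eta i p = 0) -> forall i, ~~ J i -> c i = 0.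
Proof.
move=> c0; pose r := \row_i (if J i then 0 else c i).
have rN : r *m N = 0.
  apply/rowP => l; rewrite !mxE -[RHS](c0 (linpoly (lam l))) [in RHS]big_mkcond.
  by apply: eq_bigr => i _; rewrite !mxE; case: (J i) => //=; rewrite mul0r.
have : (r *m N) *m \adj N = 0 by rewrite rN mul0mx.
rewrite -mulmxA mul_mx_adj mul_mx_scalar => /eqP.
rewrite scalemx_eq0 (negPf detN0) => /eqP/rowP r0 i /negPf Ji.
by have := r0 i; rewrite !mxE Ji.
Qed.

(** Cramer's rule writes [\det N] times [theta] with coefficients [r'], each the determinant of [N]
    with one row replaced by the values of [theta]. On a hyperplane [lker a] of [B] the coefficients
    of [a] form a kernel vector of this matrix when the replaced row is unmasked; so [r'] vanishes
    there and is divisible by [\det N]. *)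
Lemma saito_span (theta : S -> S) : logder B theta ->
  exists c : 'I_m -> S, forall p, theta p = \sum_(i | ~~ J i) c i * eta i p.
Proof.
move=> /logderP[dth thB]; pose r := \row_l theta (linpoly (lam l)).
have [r' r'N r'C] : exists2 r' : 'rV_m, r' *m N = \det N *: r &
    forall i, r' 0 i = \det (subst_row N i r).
  exists (r *m \adj N); last by move=> i; rewrite cramer_row.
  by rewrite -mulmxA mul_adj_mx mul_mx_scalar.
(* The forms [lam l] with [l] in [J] vanish, so these columns are unit vectors, and [r'] will be
   zero at the masked indices. *)
have Ncol i l : J l -> N i l = (i == l)%:R.
  rewrite !mxE => Jl; case: ifP => [//|Ji].
  rewrite lamJ // linear0; case: eqVneq => [il|_]; first by rewrite il Jl in Ji.
  by have /etaB[di _] := negbT Ji; rewrite der0.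
have r'J l : J l -> r' 0 l = 0.
  move=> Jl; have /rowP/(_ l) := r'N; rewrite !mxE lamJ // linear0 der0 // mulr0.
  rewrite (bigD1 l) //= big1 ?addr0 ?Ncol ?eqxx ?mulr1 // => i il.
  by rewrite Ncol // (negPf il) mulr0.
have /choice[c cE] : forall i, exists g, ~~ J i -> r' 0 i = \det N * g.
  move=> i; have [Ji|nJi] := boolP (J i); first by exists 0.
  have [|g gE] := detN_dvd (f := r' 0 i); last by exists g.
  move=> a a0 aB; rewrite r'C -det_map_mx.
  have [w wE] := lam_span a.
  (* Since [lam l = 0] for masked [l], these coefficients may be set to 0; then the unit rows kill
     the vector as well. *)
  pose w' l := if J l then 0 else w l.
  have {}wE : a = \sum_l w' l *: lam l.
    rewrite wE; apply: eq_bigr => l _; rewrite /w'.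
    by case: ifP => [/lamJ->|//]; rewrite !scaler0.
  apply: (@det_ker0 _ _ _ (\col_l (w' l)%:MP)).
    apply: contraNneq a0 => /colP w0; rewrite wE big1 // => l _.
    have := w0 l; rewrite !mxE => /eqP; rewrite mpolyC_eq0 => /eqP->.
    by rewrite scale0r.
  apply/colP => k; rewrite !mxE.
  have comb eta0 : is_derivation eta0 -> resS (lker a) (eta0 (linpoly a)) = 0 ->
      \sum_l resS (lker a) (eta0 (linpoly (lam l))) * (w' l)%:MP = 0.
    have -> : linpoly a = \sum_l w' l *: linpoly (lam l).
      by rewrite wE linear_sum; apply: eq_bigr => l _; rewrite linearZ.
    move=> de e0; apply: (etrans _ e0); rewrite (der_sum de) resS_sum.
    by apply: eq_bigr => l _; rewrite (derZ de) resSZ mulrC mul_mpolyC.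
  have [->|ki] := eqVneq k i.
    rewrite -[RHS](comb _ dth (thB _ aB)); apply: eq_bigr => l _.
    by rewrite !mxE eqxx.
  have [Jk|nJk] := boolP (J k).
    rewrite big1 // => l _; rewrite !mxE (negPf ki) Jk.
    case: eqVneq => [<-|_]; first by rewrite /w' Jk mpolyC0 mulr0.
    by rewrite rmorph0 mul0r.
  have /logderP[dk kB] := etaB nJk.
  rewrite -[RHS](comb _ dk (kB _ aB)); apply: eq_bigr => l _.
  by rewrite !mxE (negPf ki) (negPf nJk).
exists c; apply: der_ext => //.
  have dz : is_derivation (fun _ : S => 0 : S).
    by split=> [k f g|f g]; rewrite ?scaler0 ?mul0r ?mulr0 addr0.
  pose eta' i := if J i then fun=> 0 else eta i.
  have : is_derivation (fun p => \sum_(i | ~~ J i) c i * eta' i p).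
    apply: is_derivation_comb => i; rewrite /eta'; case: ifPn => // /etaB.
    by case.
  congr is_derivation; apply/funext => p; apply: eq_bigr => i /negPf Ji.
  by rewrite /eta' Ji.
have thl l : theta (linpoly (lam l)) = \sum_(i | ~~ J i) c i * eta i (linpoly (lam l)).
  apply: (mulfI detN0); have /rowP/(_ l) := r'N; rewrite !mxE => <-.
  rewrite mulr_sumr [in RHS]big_mkcond; apply: eq_bigr => i _.
  case: ifPn => [nJi|]; last by rewrite negbK => /r'J ->; rewrite mul0r.
  by rewrite cE // !mxE (negPf nJi) mulrA.
move=> i; rewrite -linpoly_coord.
have [w ->] := lam_span (linfun (coord (vbasis {:W}) i : W -> K^o)).
rewrite linear_sum (der_sum dth).
under [in RHS]eq_bigr => k nJk do
  (have [dk _] := etaB nJk; rewrite (der_sum dk) mulr_sumr).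
rewrite exchange_big /=; apply: eq_bigr => l _.
rewrite linearZ /= (derZ dth) thl scaler_sumr; apply: eq_bigr => k nJk.
by have [dk _] := etaB nJk; rewrite (derZ dk) scalerAr.
Qed.

End Saito.

(** * Restriction along a chain of hyperplanes *)

Section Chain.
Variables (K : fieldType) (V : vectType K).
Local Notation S := {mpoly K[\dim {:V}]}.
Variables (m : nat) (psi : 'I_m -> S -> S) (lam : 'I_m -> 'Hom(V, K^o)).
Variable sB : seq 'Hom(V, K^o).
Let cap (r : seq 'I_m) := (\bigcap_(j <- r) lker (lam j))%VS.
Hypothesis psi_der : forall i, is_derivation (psi i).
Hypothesis psiB : forall i b, b \in sB ->
  exists g, psi i (linpoly b) = linpoly b * g.
Hypothesis sB_uniq : uniq (map (fun b => lker b) sB).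
Hypothesis det_dvd : exists g, prodlin sB = \det (der_mx psi lam) * g.

(* The submatrix of [der_mx psi lam] on the complement of [r] is encoded as the
   full matrix with the rows in [r] replaced by unit rows.  Passing from
   [Y = cap r] to [X = cap (i :: r)] divides the determinant by
   [psi i (lam i)], which on [X] is a multiple of the forms of the restriction
   to [Y] that become redundant on [X]. *)
Lemma restriction_chain (r : seq 'I_m) :
  uniq r ->
  (forall i j, j \in r -> i != j -> resS (lker (lam j)) (psi i (linpoly (lam j))) = 0) ->
  (forall b, b \in sB -> ~~ (cap r <= lker b)%VS) ->
  exists s, [/\ {subset s <= sB},
    uniq [seq (cap r :&: lker a)%VS | a <- s] &
    dvd_on (cap r) (\det (mask_rows (mem r) (der_mx psi lam))) (prodlin s)].
Proof.
elim: r => [_ _ _|i r IH].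
  exists sB; split=> //.
    by rewrite (eq_map (g := fun b => lker b)) // => b; rewrite /cap big_nil capfv.
  have -> : mask_rows (mem [::]) (der_mx psi lam) = der_mx psi lam.
    by apply/matrixP => k l; rewrite !mxE.
  by have [g gE] := det_dvd; exists g; rewrite gE.
rewrite cons_uniq => /andP[ir ur] psir nv.
set X := cap (i :: r); set Y := cap r.
have XY : X = (Y :&: lker (lam i))%VS by rewrite /X /cap big_cons capvC.
have XsubY : (X <= Y)%VS by rewrite XY capvSl.
have nvY b : b \in sB -> ~~ (Y <= lker b)%VS.
  by move=> /nv; apply: contra; apply: subv_trans.
have [|//|s [sub us dvd]] := IH ur.
  by move=> k j jr; apply: psir; rewrite inE jr orbT.
have [|b /sub/nv //|s1 [rest [perm us1 drest]]] := @split_traces _ _ X s.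
  exact: map_uniq us.
have sub1 b : b \in s1 ++ rest -> b \in sB by rewrite -(perm_mem perm) => /sub.
exists s1; split; [by move=> b bs1; rewrite sub1 // mem_cat bs1 | exact: us1 |].
(* [psi i] is tangent to [Y], being tangent to each [lker (lam j)] with [j] in [r]; hence
   [dvd_on_group] covers each class of equal traces. *)
have {}drest : dvd_on X (prodlin rest) (psi i (linpoly (lam i))).
  apply: drest => c t cs ut ts ct tE; rewrite XY.
  apply: (@dvd_on_group _ _ _ _ _ s c) => //; rewrite -?XY //.
  - apply: tangent_cap => // j jr; apply: psir; first by rewrite inE jr orbT.
    by apply: contraNneq ir => ->.
  - by move=> b /sub; apply: psiB.
  - by move=> b /sub; apply: nv.
  exact: uniq_map_injin us.
(* On [X], column [i] keeps only its diagonal entry, because every other row is either masked or a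
   derivation tangent to [lker (lam i)]. *)
have detE : resS X (\det (mask_rows (mem r) (der_mx psi lam))) =
    resS X (psi i (linpoly (lam i)) * \det (mask_rows (mem (i :: r)) (der_mx psi lam))).
  rewrite resSM -!det_map_mx /=; set A := map_mx _ _; set B := map_mx _ _.
  have -> : resS X (psi i (linpoly (lam i))) = A i i by rewrite !mxE /= (negPf ir).
  apply: det_single_col => [k l ki|k ki|].
  - by rewrite !mxE /= in_cons (negPf ki).
  - rewrite !mxE /=; case: ifP => kr; first by rewrite (negPf ki) rmorph0.
    apply: (@resS_sub _ _ _ (lker (lam i))); first by rewrite XY capvSr.
    by rewrite psir // mem_head.
  by rewrite !mxE /= mem_head eqxx rmorph1.
have rest0 : resS X (prodlin rest) != 0.
  by apply: resS_prodlin_neq0 => b br; rewrite nv // sub1 // mem_cat br orbT.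
(* The old determinant is [psi i (lam i)] times the new one and divides [prodlin s]; the factor
   [rest] of [psi i (lam i)] cancels and leaves [s1]. *)
apply: (@dvd_on_cancel _ _ _ (prodlin rest)) => //.
have sE : prodlin s = prodlin rest * prodlin s1.
  by rewrite mulrC -prodlin_cat; apply: perm_big.
rewrite -sE; have [h hE] := dvd_onW XsubY dvd; have [k kE] := drest.
exists (k * h); rewrite hE resSM detE !resSM kE !resSM.
by ring.
Qed.

End Chain.

(** * Degrees, hyperplanes and Terao's polynomial *)

Section Homogeneity.
Variable K : fieldType.

Lemma dhomog_linpoly (W : vectType K) (a : 'Hom(W, K^o)) : linpoly a \is 1.-homog.
Proof.
rewrite rpred_sum // => i _; rewrite rpredZ //.
by rewrite dhomogX; apply/eqP; exact: mdeg1.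
Qed.

Lemma dhomog_pullback (V W : vectType K) (h : 'Hom(W, V)) d f :
  f \is d.-homog -> pullback h f \is d.-homog.
Proof.
move=> /dhomogP fd; rewrite [f]mpolyE linear_sum big_seq rpred_sum // => m /fd <-.
rewrite linearZ rpredZ //= mpolyXE_id rmorph_prod /= mdegE.
elim/big_rec2: _ => [|i e p _ pe]; first exact: dhomog1.
apply: dhomogM => //; rewrite rmorphXn /= pullbackX -[X in X.-homog]mul1n.
by apply: dhomogMn; apply: dhomog_linpoly.
Qed.

Lemma dhomog_prodlin (V : vectType K) (t : seq 'Hom(V, K^o)) :
  prodlin t \is (size t).-homog.
Proof.
elim: t => [|a t IH]; first by rewrite /prodlin big_nil dhomog1.
by rewrite prodlin_cons /= -add1n dhomogM ?dhomog_linpoly.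
Qed.

Lemma msize_dhomog n d (f : {mpoly K[n]}) : f != 0 -> f \is d.-homog -> msize f = d.+1.
Proof.
move=> f0 fd; have := dhomog_uniq f0 fd (dhomog_msize fd) => ->.
by rewrite prednK // lt0n msize_poly_eq0.
Qed.

(** The degrees leave room only for a constant quotient, and a nonzero one forces [d = e]. *)
Lemma dhomog_divisor n d e (f P h : {mpoly K[n]}) : P != 0 ->
  f \is d.-homog -> P \is e.-homog -> (d <= e)%N -> f = P * h ->
  exists2 c : K, f = c *: P & (d < e)%N -> c = 0.
Proof.
move=> P0 fd Pe de fE; have [f0|f0] := eqVneq f 0.
  by exists 0; rewrite // f0 scale0r.
have h0 : h != 0 by apply: contraNneq f0 => h0; rewrite fE h0 mulr0.
have := msize_dhomog f0 fd; rewrite {1}fE msizeM // (msize_dhomog P0 Pe).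
have hs : (0 < msize h)%N by rewrite lt0n msize_poly_eq0.
rewrite addSn /= => ed.
have ed' : e = d by apply/eqP; rewrite eqn_leq de andbT -ltnS -ed -addn1 leq_add2l.
have hc : msize h = 1%N by apply/eqP; rewrite -(eqn_add2l e) ed ed' addn1.
exists (h@_0); last by rewrite ed' ltnn.
by rewrite -mul_mpolyC mulrC -msize1_polyC ?hc.
Qed.

Lemma homog_der_linpoly (V : vectType K) d
    (theta : {mpoly K[\dim {:V}]} -> {mpoly K[\dim {:V}]}) (a : 'Hom(V, K^o)) :
  is_derivation theta -> homog_der d theta -> theta (linpoly a) \is d.-homog.
Proof.
move=> dth th; rewrite (der_linpoly dth) rpred_sum // => i _.
by rewrite rpredZ // th.
Qed.

End Homogeneity.

Section Hyperplanes.
Variables (K : fieldType) (V : vectType K).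
Implicit Types (U X Y H : {vspace V}) (a b : 'Hom(V, K^o)) (A C : {fset {vspace V}}).

Lemma dim_cap_ker U a : (\dim U <= (\dim (U :&: lker a)).+1)%N.
Proof.
rewrite -(limg_ker_dim a U) -addn1 leq_add2l.
by rewrite (leq_trans (dimvS (subvf _))) // dimvf.
Qed.

Lemma dim_bigcap U (I : Type) (r : seq I) (P : pred I) (F : I -> 'Hom(V, K^o)) :
  (\dim U <= \dim (U :&: \bigcap_(i <- r | P i) lker (F i)) + count P r)%N.
Proof.
elim: r U => [|i r IH] U /=; first by rewrite big_nil capvf addn0.
rewrite big_cons; case: (P i); rewrite ?add0n // add1n addnS capvA.
by apply: leq_trans (dim_cap_ker U (F i)) _; rewrite ltnS.
Qed.

Definition form H : 'Hom(V, K^o) := xget 0 [set a | lker a = H]%classic.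

Lemma formK H : (\dim H).+1 = \dim {:V} -> lker (form H) = H.
Proof.
move=> /hyperplane_ker[a aH].
by rewrite /form; case: xgetP => [b _ //|/(_ a)]; rewrite /= aH.
Qed.

(** If [w j] were nonzero, the kernel of [al j] would contain the intersection of the others, and
    [p - 1] hyperplanes would lower the dimension by [p]. *)
Lemma independent_forms p (al : 'I_p -> 'Hom(V, K^o)) :
  \dim {:V} = (\dim (\bigcap_(j < p) lker (al j)) + p)%N ->
  forall w : 'I_p -> K, \sum_j w j *: al j = 0 -> forall j, w j = 0.
Proof.
move=> dimE w w0 j; apply/eqP; apply: contraT => wj.
have capE : (\bigcap_(i < p) lker (al i) = \bigcap_(i < p | i != j) lker (al i))%VS.
  rewrite (bigD1 j) //=; apply/capv_idPr/subvP => v vI.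
  have ai i : i != j -> al i v = 0.
    move=> ij; apply/eqP; rewrite -memv_ker; apply: subvP vI.
    by rewrite (bigD1 i) //= capvSl.
  move/lfunP: w0 => /(_ v); rewrite sum_lfunE (bigD1 j) //= big1 => [|i ij].
    rewrite addr0 scale_lfunE zero_lfunE => /eqP.
    by rewrite mulf_eq0 (negPf wj) memv_ker.
  by rewrite scale_lfunE ai // scaler0.
have := dim_bigcap fullv (index_enum 'I_p) (fun i => i != j) al.
rewrite capfv -capE dimE leq_add2l.
rewrite -sum1_count (eq_bigl (predC1 j)) // sum1_card cardC1 card_ord.
by case: p j {al w w0 wj capE dimE} => [[]//|p _]; rewrite ltnn.
Qed.

End Hyperplanes.

Section Forms.
Variables (K : fieldType) (V : vectType K).
Local Notation S := {mpoly K[\dim {:V}]}.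
Implicit Types (U X Y H : {vspace V}) (a b : 'Hom(V, K^o)) (A C : {fset {vspace V}}).

Definition forms A : seq 'Hom(V, K^o) := [seq form H | H <- A].

Lemma form_mem A b : is_arrangement A -> b \in forms A -> lker b \in A.
Proof. by move=> hA /mapP[H HA ->]; rewrite formK ?hA. Qed.

Lemma map_lker_forms A : is_arrangement A -> map (fun b => lker b) (forms A) = A.
Proof.
move=> hA; rewrite -map_comp -[RHS]map_id; apply/eq_in_map => H HA /=.
by rewrite formK ?hA.
Qed.

Lemma hyperplane_not_full A H : is_arrangement A -> H \in A -> ~~ (fullv <= H)%VS.
Proof. by move=> hA /hA dH; apply/negP => /dimvS; rewrite -dH ltnn. Qed.

Lemma forms_dvd A (f : S) : is_arrangement A ->
  (forall a, lker a \in A -> resS (lker a) f = 0) ->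
  exists g, f = prodlin (forms A) * g.
Proof.
move=> hA f0; apply: dvd_on_fullv; apply: prodlin_dvd_on.
- by move=> b /(form_mem hA); apply: hyperplane_not_full.
- rewrite (eq_map (g := fun b => lker b)) => [|b]; last by rewrite capfv.
  by rewrite map_lker_forms // fset_uniq.
by move=> b /(form_mem hA)/f0 fb; apply: dvd_on_ker; rewrite capfv.
Qed.

Lemma logder_dvd A theta b : is_arrangement A -> logder A theta -> b \in forms A ->
  exists g, theta (linpoly b) = linpoly b * g.
Proof. by move=> hA [_ th] bA; apply: (th (lker b)) => //; apply: form_mem. Qed.

Lemma ev_prodlin_neq0 v (s : seq 'Hom(V, K^o)) :
  (forall b, b \in s -> v \notin lker b) -> ev v (prodlin s) != 0.
Proof.
elim: s => [_|b s IH vs]; first by rewrite /prodlin big_nil /ev meval1 oner_neq0.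
rewrite prodlin_cons /ev mevalM mulf_neq0 //.
  by rewrite -/(ev _ _) ev_linpoly; have := vs b (mem_head _ _); rewrite memv_ker.
by apply: IH => c cs; rewrite vs // inE cs orbT.
Qed.

Lemma preim_incl_trace X H1 H2 :
  (linfun (@vsval K V X) @^-1: H1 = linfun (@vsval K V X) @^-1: H2)%VS ->
  (X :&: H1 = X :&: H2)%VS.
Proof.
move=> H12; apply/vspaceP => v; rewrite !memv_cap; apply: andb_id2l => vX.
have vE : v = linfun (@vsval K V X) (vsproj X v) by rewrite -[linfun _]/(incl X) inclE vsprojK.
by rewrite vE !memv_preim H12.
Qed.

(* Terao's polynomial B, of degree [#|A| - #|A^H|]. *)
Lemma terao_polynomial A a m : is_arrangement A ->
  (forall H, H \in A -> ~~ (lker a <= H)%VS) ->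
  (#|` restriction (lker a |` A)%fset (lker a)| + m <= #|` A|)%N ->
  exists2 s, {subset s <= forms A} & (m <= size s)%N /\
    forall theta, logder A theta -> dvd_on (lker a) (prodlin s) (theta (linpoly a)).
Proof.
move=> hA nv cardA.
have nvb b : b \in forms A -> ~~ (lker a <= lker b)%VS by move=> /(form_mem hA)/nv.
have uA : uniq (map (fun b => lker b) (forms A)) by rewrite map_lker_forms // fset_uniq.
have [//|//|s1 [s [perm us1 ds]]] := @split_traces _ _ (lker a) (forms A).
  exact: map_uniq uA.
exists s; first by move=> b bs; rewrite (perm_mem perm) mem_cat bs orbT.
split.
  (* The representatives [s1] have distinct traces, so there are at most as many as hyperplanes in
     the restriction; at least [m] redundant forms remain. *)
  rewrite -(leq_add2l (size s1)) -size_cat -(perm_size perm) size_map.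
  apply: leq_trans cardA; rewrite leq_add2r.
  pose tr b := (linfun (@vsval K V (lker a)) @^-1: lker b)%VS.
  rewrite -(size_map tr); apply: uniq_leq_size.
    rewrite map_inj_in_uniq; first exact: map_uniq us1.
    move=> b b' bs bs' /preim_incl_trace; exact: uniq_map_injin us1 _ _ bs bs'.
  move=> _ /mapP[b bs1 ->]; have bA : b \in forms A by rewrite (perm_mem perm) mem_cat bs1.
  apply/imfsetP; exists (lker b) => //=.
  by rewrite !inE nvb // andbT (form_mem hA bA) orbT.
move=> theta th; have [dth _] := th; apply: ds => c t cs ut ts ct tE.
rewrite -[lker a]capfv; apply: (@dvd_on_group _ _ _ _ _ (forms A) c) => //.
- by move=> f /resS_fullv->; rewrite der0 // resS0.
- by move=> b; apply: logder_dvd.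
- by move=> b bA; rewrite capfv nvb.
- by move=> b b' bA bA'; rewrite !capfv; apply: uniq_map_injin uA _ _ bA bA'.
by move=> b bt; rewrite capfv tE.
Qed.

Definition crd i : 'Hom(V, K^o) := linfun (coord (vbasis {:V}) i : V -> K^o).

Lemma linpoly_crd i : linpoly (crd i) = 'X_i.
Proof. exact: linpoly_coord. Qed.

Lemma crd_span a : a = \sum_(i < \dim {:V}) a (vbasis {:V})`_i *: crd i.
Proof.
apply: linpoly_inj; rewrite linear_sum /=; apply: eq_bigr => i _.
by rewrite linearZ /= linpoly_crd.
Qed.

End Forms.

(** The last clause is Saito's criterion as a divisibility; for an arrangement it makes [theta] a
    basis of the logarithmic derivations ([stage_basis_list]). The bound [d i <= m] is what makes
    the quotients by Terao's polynomial constant. *)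
Definition stage_basis (K : fieldType) (V : vectType K) (A : {fset {vspace V}}) (m : nat)
    (theta : 'I_(\dim {:V}) -> {mpoly K[\dim {:V}]} -> {mpoly K[\dim {:V}]})
    (d : 'I_(\dim {:V}) -> nat) : Prop :=
  [/\ forall i, logder A (theta i), forall i, homog_der (d i) (theta i),
      forall i, (d i <= m)%N &
      exists g, prodlin (forms A) = \det (der_mx theta (@crd K V)) * g].

(** * One step of the MAT-partition *)

Section Adapted.
Variables (K : fieldType) (V : vectType K).
Local Notation n := (\dim {:V}).
Local Notation S := {mpoly K[n]}.
Variables (A : {fset {vspace V}}) (m p : nat).
Variables (theta : 'I_n -> S -> S) (d : 'I_n -> nat).
Variables (al : 'I_p -> 'Hom(V, K^o)) (v : V).
Hypothesis hA : is_arrangement A.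
Hypothesis basis_th : stage_basis A m theta d.
Hypothesis al_free : forall w : 'I_p -> K, \sum_j w j *: al j = 0 -> forall j, w j = 0.
Hypothesis alv : forall j, v \in lker (al j).
Hypothesis Av : forall H, H \in A -> v \notin H.
Hypothesis cardA : forall j, 
  (#|` restriction (lker (al j) |` A)%fset (lker (al j))| + m <= #|` A|)%N.

Lemma ev_det_neq0 : ev v (\det (der_mx theta (@crd K V))) != 0.
Proof.
have [_ _ _ [g gE]] := basis_th; have : ev v (prodlin (forms A)) != 0.
  by apply: ev_prodlin_neq0 => b /(form_mem hA)/Av.
by rewrite gE /ev mevalM mulf_eq0 negb_or => /andP[].
Qed.

Lemma MAT_coefficients : exists (c : 'M[K]_(n, p)) (P : 'I_p -> S),
  [/\ row_full c, forall i j, (d i < m)%N -> c i j = 0 &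
    forall i j, resS (lker (al j)) (theta i (linpoly (al j))) =
      c i j *: resS (lker (al j)) (P j)].
Proof.
have [thA thd dm det_dvd] := basis_th.
have nv j H : H \in A -> ~~ (lker (al j) <= H)%VS.
  by move=> /Av; apply: contra => /subvP; apply.
have /choice[s sP] : forall j, exists s, {subset s <= forms A} /\ (m <= size s)%N /\
    forall theta, logder A theta -> dvd_on (lker (al j)) (prodlin s) (theta (linpoly (al j))).
  by move=> j; have [s sA sP] := terao_polynomial hA (nv j) (cardA j); exists s.
have s0 j b : b \in s j -> ~~ (lker (al j) <= lker b)%VS.
  by have [sA _] := sP j; move=> bs; apply: nv; apply: form_mem hA _; apply: sA.
have cP i j : exists c : K, resS (lker (al j)) (theta i (linpoly (al j))) =
      c *: resS (lker (al j)) (prodlin (s j)) /\ ((d i < m)%N -> c = 0).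
  (* On [lker (al j)] a polynomial of degree [d i <= m] is a multiple of one of degree at least [m],
     so the quotient is constant, and zero if [d i < m]. *)
  have [sA [ms sdvd]] := sP j; have [h hE] := sdvd _ (thA i).
  have P0 := resS_prodlin_neq0 (s0 j).
  have fd : resS (lker (al j)) (theta i (linpoly (al j))) \is (d i).-homog.
    by apply: dhomog_pullback; apply: homog_der_linpoly (thd i); case: (thA i).
  have Pd : resS (lker (al j)) (prodlin (s j)) \is (size (s j)).-homog.
    by apply: dhomog_pullback; apply: dhomog_prodlin.
  rewrite resSM in hE.
  have [c cE c0] := dhomog_divisor P0 fd Pd (leq_trans (dm i) ms) hE.
  by exists c; split=> // dim; apply: c0; apply: leq_trans ms.
pose c : 'M[K]_(n, p) := \matrix_(i, j) projT1 (cid (cP i j)).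
have cE i j : resS (lker (al j)) (theta i (linpoly (al j))) =
      c i j *: resS (lker (al j)) (prodlin (s j)) /\ ((d i < m)%N -> c i j = 0).
  by rewrite mxE; case: cid.
exists c, (fun j => prodlin (s j)); split=> [|i j dim|i j]; last by case: (cE i j).
  2: by have [_ ->] := cE i j.
(* Values at [v] give [Th *m Lam = c *m diag_mx D]. [Th] is invertible because [v] avoids [A], and
   [Lam] has rank [p] because the [al j] are independent; hence [c] has rank [p]. *)
pose Th : 'M[K]_n := \matrix_(i, l) ev v (theta i 'X_l).
pose Lam : 'M[K]_(n, p) := \matrix_(l, j) al j (vbasis {:V})`_l.
pose D : 'rV[K]_p := \row_j ev v (prodlin (s j)).
have ThLam : Th *m Lam = c *m diag_mx D.
  apply/matrixP => i j; rewrite mul_mx_diag !mxE.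
  have [ciE _] := cE i j; rewrite -resSZ in ciE.
  have := ev_onE (alv j) ciE; rewrite /ev mevalZ -!/(ev _ _) mxE => <-.
  have [di _] := thA i; rewrite (der_linpoly di) /ev raddf_sum /=.
  by apply: eq_bigr => l _; rewrite !mxE mevalZ mulrC.
have ThE : Th = map_mx (ev v) (der_mx theta (@crd K V)).
  by apply/matrixP => i l; rewrite !mxE linpoly_crd.
have Th_unit : Th \in unitmx.
  rewrite unitmxE unitfE ThE.
  by have := ev_det_neq0; rewrite /ev -det_map_mx.
rewrite /row_full eqn_leq rank_leq_col /=.
apply: leq_trans (mxrankM_maxl c (diag_mx D)); rewrite -ThLam.
have /eqmxMfull -> : row_full Th by rewrite row_full_unit.
have : row_free Lam^T.
  apply: inj_row_free => w wL; apply/rowP => j; rewrite [RHS]mxE.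
  apply: (al_free (w := fun j => w 0 j)).
  apply/lfunP => x.
  rewrite (coord_vbasis (memvf x)) !linear_sum; apply: eq_bigr => l _.
  rewrite !linearZ /=; congr (_ *: _).
  move/rowP: wL => /(_ l); rewrite [RHS]mxE mxE => wl.
  rewrite zero_lfunE sum_lfunE; apply: (etrans _ wl).
  by apply: eq_bigr => k _; rewrite !mxE scale_lfunE.
by rewrite /row_free mxrank_tr => /eqP->.
Qed.


(* [psi] arises from [theta] by a constant base change [U] bringing the matrix
   of coefficients into the form [G] with unit rows; [F] and [G] select the rows
   picked by [f] and [E] projects onto the other ones. *)
Lemma adapted_basis : exists (f : 'I_p -> 'I_n) (psi : 'I_n -> S -> S),
  [/\ injective f, forall j, d (f j) = m, stage_basis A m psi d,
    forall i j, f j != i -> resS (lker (al j)) (psi i (linpoly (al j))) = 0 &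
    forall i, (forall j, f j != i) -> exists2 t : 'I_p -> K,
      forall q, psi i q = theta i q + \sum_j t j *: theta (f j) q &
      (d i < m)%N -> forall j, t j = 0].
Proof.
have [thA thd dm [g gE]] := basis_th.
have [c [P [cfull c0 cE]]] := MAT_coefficients.
pose f := fullrankfun cfull; have cu := fullrowsub_unit cfull.
have finj : injective f := @fullrankfun_inj _ _ _ _ cfull.
pose T := invmx (rowsub f c).
pose F : 'M[K]_(p, n) := rowsub f 1%:M; pose G := F^T.
have FE j l : F j l = (f j == l)%:R by rewrite !mxE.
have Fc : F *m c = rowsub f c by rewrite -rowsubE.
have FG : F *m G = 1%:M.
  apply/matrixP => j k; rewrite !mxE (bigD1 (f j)) //= big1 => [|l lj].
    by rewrite !mxE eqxx mul1r addr0 (inj_eq finj) eq_sym.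
  by rewrite FE eq_sym (negPf lj) mul0r.
have [E defE] : exists E, E = 1%:M - G *m F by exists (1%:M - G *m F).
have FE0 : F *m E = 0 by rewrite defE mulmxBr mulmx1 mulmxA FG mul1mx subrr.
have EG0 : E *m G = 0 by rewrite defE mulmxBl mul1mx -mulmxA FG mulmx1 subrr.
have EE : E *m E = E by rewrite {1}defE mulmxBl mul1mx -mulmxA FE0 mulmx0 subr0.
have TFc : T *m F *m c = 1%:M by rewrite -mulmxA Fc mulVmx.
have FcT : F *m c *m T = 1%:M by rewrite Fc mulmxV.
have [X defX] : exists X, X = 1%:M - c *m T *m F by exists (1%:M - c *m T *m F).
have FX0 : F *m X = 0 by rewrite defX mulmxBr mulmx1 !mulmxA FcT mul1mx subrr.
have Xc0 : X *m c = 0 by rewrite defX mulmxBl mul1mx -!mulmxA [T *m _]mulmxA TFc mulmx1 subrr.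
(* The picked rows of [U] are those of [T *m F], which invert the picked square block of [c]. Any
   other row is that of [X], which subtracts the combination of picked rows cancelling the
   corresponding row of [c]. [U'] is the inverse. *)
pose U := G *m T *m F + E *m X.
pose U' := c *m F + E.
have U'U : U' *m U = 1%:M.
  rewrite mulmxDl !mulmxDr !mulmxA -[c *m F *m G]mulmxA FG mulmx1 EG0 !mul0mx add0r.
  rewrite -[c *m F *m E]mulmxA FE0 mulmx0 mul0mx addr0 EE.
  by rewrite defE mulmxBl mul1mx -[G *m F *m X]mulmxA FX0 mulmx0 subr0 defX addrC subrK.
have Uc : U *m c = G.
  by rewrite mulmxDl -!mulmxA Xc0 mulmx0 addr0 [T *m _]mulmxA TFc mulmx1.
have FU : F *m U = T *m F.
  by rewrite mulmxDr !mulmxA FE0 mul0mx addr0 FG mul1mx.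
pose psi i q := \sum_l (U i l)%:MP * theta l q.
have sumF k (M : 'M[K]_(k, p)) i q :
    \sum_l ((M *m F) i l)%:MP * theta l q = \sum_j M i j *: theta (f j) q.
  under eq_bigr => l _ do rewrite mxE raddf_sum /= mulr_suml.
  rewrite exchange_big /=; apply: eq_bigr => j _.
  rewrite (bigD1 (f j)) //= big1 ?addr0 => [|l lj]; last first.
    by rewrite FE eq_sym (negPf lj) mulr0 mpolyC0 mul0r.
  by rewrite FE eqxx mulr1 mul_mpolyC.
have psif j q : psi (f j) q = \sum_k T j k *: theta (f k) q.
  rewrite -sumF -FU; apply: eq_bigr => l _; congr (_%:MP * _).
  by rewrite /F -rowsubE [in RHS]mxE.
have psiN i : (forall j, f j != i) ->
    forall q, psi i q = theta i q + \sum_j (- (c *m T) i j) *: theta (f j) q.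
  move=> fi q; have UE l : U i l = (i == l)%:R - (c *m T *m F) i l.
    have Gi k (M : 'M[K]_(p, k)) j : (G *m M) i j = 0.
      by rewrite mxE big1 // => r _; rewrite mxE FE (negPf (fi r)) mul0r.
    rewrite /U -[G *m T *m F]mulmxA [LHS]mxE Gi add0r.
    rewrite defE mulmxBl mul1mx -[G *m F *m X]mulmxA FX0 mulmx0 subr0.
    by rewrite defX [LHS]mxE; congr (_ + _); rewrite [LHS]mxE.
  rewrite /psi; under eq_bigr => l _ do rewrite UE mpolyCB mulrBl.
  rewrite sumrB sumF (bigD1 i) //= big1 ?addr0 => [|l li]; last first.
    by rewrite eq_sym (negPf li) mpolyC0 mul0r.
  rewrite eqxx mul1r -sumrN; congr (_ + _); apply: eq_bigr => j _.
  by rewrite scaleNr.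
(* A row of [c] of degree below [m] is zero and cannot occur in an invertible block. *)
have dfm j : d (f j) = m.
  apply/eqP; rewrite eqn_leq dm leqNgt; apply/negP => lt_m.
  move/matrixP: FcT => /(_ j j)/eqP; rewrite Fc !mxE eqxx big1 ?(eq_sym 0) ?oner_eq0 //.
  by move=> k _; rewrite mxE c0 // mul0r.
(* Elements of degree below [m] receive no terms of degree [m], so [psi] stays homogeneous of the
   same degrees. *)
have cT0 i j : (d i < m)%N -> - (c *m T) i j = 0.
  by move=> im; rewrite mxE big1 ?oppr0 // => k _; rewrite c0 // mul0r.
exists f, psi; split; [exact: finj | exact: dfm | | |].
- split; [by move=> i; apply: logder_comb | | exact: dm |].
  + move=> i; have [/existsP[j /eqP <-]|] := boolP [exists j, f j == i].
      by move=> l; rewrite psif rpred_sum // => k _; rewrite rpredZ // dfm -(dfm k) thd.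
    rewrite negb_exists => /forallP fi l; rewrite psiN // rpredD ?thd //.
    rewrite rpred_sum // => j _; have := dm i; rewrite leq_eqVlt => /orP[/eqP dim|im].
      by rewrite rpredZ // dim -(dfm j) thd.
    by rewrite cT0 // scale0r rpred0.
  exists ((\det U')%:MP * g).
  have -> : der_mx psi (@crd K V) = map_mx (@mpolyC n K) U *m der_mx theta (@crd K V).
    by apply/matrixP => i l; rewrite !mxE; apply: eq_bigr => k _; rewrite !mxE.
  rewrite det_mulmx det_map_mx gE mulrACA -mpolyCM mulrC.
  have -> : \det U * \det U' = 1 by rewrite mulrC -det_mulmx U'U det1.
  by rewrite mpolyC1 mul1r.
- move=> i j ji; rewrite resS_sum.
  under eq_bigr => l _ do rewrite mul_mpolyC resSZ cE scalerA.
  rewrite -scaler_suml; move/matrixP: Uc => /(_ i j); rewrite mxE => ->.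
  by rewrite mxE FE (negPf ji) scale0r.
by move=> i fi; exists (fun j => - (c *m T) i j); [exact: psiN | move=> im j; exact: cT0].
Qed.

End Adapted.

Section Scaling.
Variables (K : fieldType) (V : vectType K).
Local Notation n := (\dim {:V}).
Local Notation S := {mpoly K[n]}.
Variables (A : {fset {vspace V}}) (p : nat) (al : 'I_p -> 'Hom(V, K^o)).
Variables (f : 'I_p -> 'I_n) (psi : 'I_n -> S -> S).
Hypothesis psiA : forall i, logder A (psi i).
Hypothesis psi_al : forall i j, f j != i ->
  resS (lker (al j)) (psi i (linpoly (al j))) = 0.

(** [D] selects the hyperplanes of the block to be added: all of them for the next stage, those
    outside [C] for the restriction. For injective [f] the product has at most one factor. *)
Definition scale_coef (D : pred 'I_p) i : S := \prod_(j | D j && (f j == i)) linpoly (al j).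
Definition scale_der (D : pred 'I_p) i (q : S) : S := scale_coef D i * psi i q.

Lemma scale_der_logder (D : pred 'I_p) (B : {fset {vspace V}}) i :
  (forall H, H \in B -> H \in A \/ exists2 j, D j & H = lker (al j)) ->
  logder B (scale_der D i).
Proof.
move=> BA; have /logderP[di iA] := psiA i; apply/logderP; split.
  split=> [k g h|g h]; rewrite /scale_der.
    by rewrite (derP di) mulrDr scalerAr.
  by rewrite (derM di) mulrDr mulrA [in RHS]mulrCA.
move=> a /BA[aA|[j Dj aj]]; first by rewrite resSM iA // mulr0.
have [k aE] : exists k : K, a = k *: al j by apply: form_subT; rewrite aj.
rewrite aj aE linearZ /scale_der (derZ di) resSM resSZ.
have [fji|/psi_al-> //] := eqVneq (f j) i; last by rewrite scaler0 mulr0.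
rewrite /scale_coef (bigD1 j) /= ?Dj ?fji ?eqxx // resSM.
have /eqP-> : resS (lker (al j)) (linpoly (al j)) == 0 by rewrite resS_linpoly_eq0.
by rewrite !mul0r.
Qed.

Lemma det_scale_der (D : pred 'I_p) lam :
  \det (der_mx (scale_der D) lam) = \prod_(j | D j) linpoly (al j) * \det (der_mx psi lam).
Proof.
have -> : der_mx (scale_der D) lam =
    diag_mx (\row_i scale_coef D i) *m der_mx psi lam.
  by apply/matrixP => i l; rewrite mul_diag_mx !mxE.
rewrite det_mulmx det_diag; congr (_ * _).
rewrite [RHS](partition_big f predT) //=; apply: eq_bigr => i _.
by rewrite mxE.
Qed.

Lemma scale_coefN (D : pred 'I_p) i : (forall j, D j -> f j != i) -> scale_coef D i = 1.
Proof.
move=> fi; rewrite /scale_coef big_pred0 // => j.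
by apply/negbTE/negP => /andP[/fi/negP].
Qed.

Lemma scale_coefE (D : pred 'I_p) j : injective f -> D j ->
  scale_coef D (f j) = linpoly (al j).
Proof.
move=> finj Dj; rewrite /scale_coef (big_pred1 j) // => k /=.
by rewrite (inj_eq finj); case: eqVneq => [->|]; rewrite ?Dj ?andbF.
Qed.

End Scaling.

Section MATStep.
Variables (K : fieldType) (V : vectType K).
Local Notation n := (\dim {:V}).
Local Notation S := {mpoly K[n]}.
Implicit Types (A C : {fset {vspace V}}).

Definition nform C (j : 'I_#|` C|) : 'Hom(V, K^o) := form (nth 0%VS C j).

Lemma nformK C j : is_arrangement C -> lker (@nform C j) = nth 0%VS C j.
Proof. by move=> hC; rewrite formK // hC // mem_nth. Qed.

Lemma nform_mem C j : is_arrangement C -> lker (@nform C j) \in C.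
Proof. by move=> hC; rewrite nformK // mem_nth. Qed.

Lemma nformP C H : is_arrangement C -> H \in C -> exists j, H = lker (@nform C j).
Proof.
move=> hC HC; have iH : (index H C < #|` C|)%N by rewrite index_mem.
by exists (Ordinal iH); rewrite nformK //= nth_index.
Qed.

Lemma bigcap_nform C (P : pred {vspace V}) : is_arrangement C ->
  (\bigcap_(j | P (lker (@nform C j))) lker (@nform C j) = \bigcap_(H <- C | P H) H)%VS.
Proof.
move=> hC; rewrite [RHS](big_nth 0%VS) big_mkord.
by apply: eq_big => j; rewrite nformK.
Qed.

Lemma prodlin_nform C : prodlin (forms C) = \prod_j linpoly (@nform C j).
Proof. by rewrite /prodlin big_map (big_nth 0%VS) big_mkord. Qed.

Lemma prodlin_formsU A C : [disjoint A & C]%fset ->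
  prodlin (forms (A `|` C)%fset) = prodlin (forms A) * prodlin (forms C).
Proof.
move=> dAC; rewrite -prodlin_cat /forms -map_cat; apply: perm_big; apply: perm_map.
apply: uniq_perm; rewrite ?cat_uniq ?fset_uniq //=.
  by rewrite andbT; apply/hasPn => H HC; apply: contraL HC => HA; exact: (fdisjointP dAC).
by move=> H; rewrite mem_cat inE.
Qed.

Lemma dim_center C : is_arrangement C -> rk C = #|` C| ->
  \dim {:V} = (\dim (center C) + #|` C|)%N.
Proof. by move=> hC <-; rewrite /rk subnKC // dimvS // subvf. Qed.

Lemma nform_free C : is_arrangement C -> rk C = #|` C| ->
  forall w : 'I_#|` C| -> K, \sum_j w j *: nform j = 0 -> forall j, w j = 0.
Proof.
move=> hC rC; apply: independent_forms; rewrite {1}(dim_center hC rC).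
by rewrite (bigcap_nform predT hC).
Qed.

Definition raise (p : nat) (f : 'I_p -> 'I_n) (d : 'I_n -> nat) i :=
  (d i + [exists j, f j == i])%N.

Definition adapted A C m (f : 'I_#|` C| -> 'I_n) (theta psi : 'I_n -> S -> S) (d : 'I_n -> nat) :=
  [/\ injective f, forall j, d (f j) = m, stage_basis A m psi d,
    forall i j, f j != i -> resS (lker (nform j)) (psi i (linpoly (nform j))) = 0 &
    forall i, (forall j, f j != i) -> exists2 t : 'I_#|` C| -> K,
      forall q, psi i q = theta i q + \sum_j t j *: theta (f j) q &
      (d i < m)%N -> forall j, t j = 0].

Lemma MAT_step A C m theta d (v : V) :
  is_arrangement A -> is_arrangement C -> stage_basis A m theta d ->
  rk C = #|` C| -> v \in center C -> (forall H, H \in A -> v \notin H) ->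
  (forall H, H \in C -> #|` A| = (#|` restriction (H |` A)%fset H| + m)%N) ->
  exists f psi, adapted A (C := C) m f theta psi d /\
    stage_basis (A `|` C)%fset m.+1 (scale_der (@nform C) f psi predT) (raise f d).
Proof.
move=> hA hC Bth rC vC vA cardA.
have vH H : H \in C -> v \in H by move=> HC; apply: subvP vC; apply: center_le.
have [||||f [psi adp]] := @adapted_basis _ _ _ _ #|` C| _ _ (@nform C) v hA Bth.
- exact: nform_free.
- by move=> j; apply/vH/nform_mem.
- exact: vA.
- by move=> j; rewrite -cardA // nform_mem.
exists f, psi; split; first exact: adp.
have [finj dfm [psiA psid dm [g gE]] psiC _] := adp.
have rE j : raise f d (f j) = m.+1.
  by rewrite /raise dfm (_ : [exists _, _]) ?addn1 //; apply/existsP; exists j.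
have scN i : [exists j, f j == i] = false -> scale_coef (@nform C) f predT i = 1.
  move=> /negbT; rewrite negb_exists => /forallP fi.
  by apply: scale_coefN => j _; apply: fi.
split.
- move=> i; apply: (scale_der_logder psiA psiC) => H; rewrite inE => /orP[|HC]; [by left|right].
  by have [j ->] := nformP hC HC; exists j.
- move=> i l; rewrite /scale_der; case E : [exists j, f j == i].
    have /existsP[j /eqP fji] := E; rewrite -fji rE (scale_coefE _ finj) // -add1n.
    by rewrite dhomogM ?dhomog_linpoly // -(dfm j) psid.
  by rewrite scN // mul1r /raise E addn0 psid.
- by move=> i; rewrite /raise -addn1 leq_add // leq_b1.
exists g; rewrite det_scale_der -prodlin_nform prodlin_formsU; last first.
  apply/fdisjointP => H HA; apply: contra (vA H HA); exact: vH.
by rewrite gE mulrC mulrA.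
Qed.

End MATStep.

(** * Uniqueness of the exponents *)

Section HomogeneousParts.
Variables (K : fieldType) (n : nat).
Local Notation S := {mpoly K[n]}.
Local Notation pih := (@pihomog n K mdeg).

Lemma pihomog_mul r d (c t : S) : t \is d.-homog ->
  pih r (c * t) = if (d <= r)%N then pih (r - d) c * t else 0.
Proof.
(* The bound is large enough both to decompose [c] and to contain the index [r - d]. *)
move=> td; pose k := (msize c + r.+1)%N.
rewrite {1}(@pihomog_partitionE n K mdeg k c) ?leq_addr //.
rewrite mulr_suml linear_sum /=.
have hj j : pih j c * t \is (j + d).-homog by apply: dhomogM => //; apply: pihomogP.
case: ifP => dr; last first.
  rewrite big1 // => j _; apply: pihomog_ne0 (hj j).
  by apply: contraFneq dr => <-; rewrite leq_addl.
have rk : (r - d < k)%N by rewrite /k addnS ltnS (leq_trans (leq_subr _ _)) ?leq_addl.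
rewrite (bigD1 (Ordinal rk)) //= big1 ?addr0 => [|j jr].
  by rewrite pihomog_dE //; have := hj (r - d)%N; rewrite subnK.
apply: pihomog_ne0 (hj j); apply: contraNneq jr => jd.
by apply/eqP/val_inj; rewrite /= -jd addnK.
Qed.

End HomogeneousParts.

Section Exponents.
Variables (K : fieldType) (V : vectType K).
Local Notation n := (\dim {:V}).
Local Notation S := {mpoly K[n]}.
Variable (A : {fset {vspace V}}).

(** Each coordinate may be replaced by its homogeneous part of degree [r - d i]; a nonzero constant
    term then forces this degree to be 0. *)
Lemma homog_coordinates m (theta : 'I_m -> S -> S) (d : 'I_m -> nat) eta r :
  is_basis (logder A) theta -> (forall i, homog_der (d i) (theta i)) ->
  logder A eta -> homog_der r eta ->
  exists c : 'I_m -> S, (forall p, eta p = \sum_i c i * theta i p) /\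
    forall i, (c i)@_0%MM != 0 -> d i = r.
Proof.
move=> [thA gen _] thd etaA etar; have [c cE] := gen _ etaA.
exists (fun i => if (d i <= r)%N then pihomog mdeg (r - d i) (c i) else 0).
split; last first.
  move=> i; case: ifP => [dr|]; last by rewrite mcoeff0 eqxx.
  apply: contraNeq => ne; apply/eqP; apply: (dhomog_nemf_coeff (mf := mdeg)).
    exact: pihomogP.
  by rewrite mf0 eq_sym subn_eq0 -ltnNge ltn_neqAle ne.
apply: der_ext => [||l]; first by case: etaA.
  by apply: is_derivation_comb => i; case: (thA i).
have := pihomog_dE (etar l); rewrite cE linear_sum /= => <-.
apply: eq_bigr => i _; rewrite (pihomog_mul _ _ (thd i l)).
by case: ifP; rewrite ?mul0r.
Qed.

(* The transition matrices [M] and [N] between two homogeneous bases may be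
   taken homogeneous; their constant parts are then block diagonal and mutually
   inverse, and comparing traces on the blocks of degree [r] counts the
   exponents equal to [r]. *)
Lemma has_exponents_perm e e' : (forall m, (m%:R : K) = 0 -> m = 0%N) ->
  has_exponents A e -> has_exponents A e' -> perm_eq e e'.
Proof.
move=> char0 [theta [bth hth]] [eta [beta heta]].
have /choice[M ME] : forall j, exists c : 'I_(size e) -> S,
    (forall p, eta j p = \sum_i c i * theta i p) /\
    forall i, (c i)@_0%MM != 0 -> nth 0%N e i = nth 0%N e' j.
  by move=> j; apply: homog_coordinates bth hth _ (heta j); case: beta.
have /choice[N NE] : forall i, exists c : 'I_(size e') -> S,
    (forall p, theta i p = \sum_j c j * eta j p) /\
    forall j, (c j)@_0%MM != 0 -> nth 0%N e' j = nth 0%N e i.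
  by move=> i; apply: homog_coordinates beta heta _ (hth i); case: bth.
have inv m1 m2 (th1 : 'I_m1 -> S -> S) (th2 : 'I_m2 -> S -> S)
    (M1 : 'I_m1 -> 'I_m2 -> S) (M2 : 'I_m2 -> 'I_m1 -> S) :
    is_basis (logder A) th1 ->
    (forall i p, th1 i p = \sum_j M1 i j * th2 j p) ->
    (forall j p, th2 j p = \sum_i M2 j i * th1 i p) ->
    forall i, \sum_j (M1 i j)@_0%MM * (M2 j i)@_0%MM = 1.
  move=> [_ _ indep] E1 E2 i.
  have /indep/(_ i) : forall p, \sum_k (\sum_j M1 i j * M2 j k - (i == k)%:R) * th1 k p = 0.
    move=> p; under eq_bigr => k _ do rewrite mulrBl mulr_suml.
    rewrite sumrB exchange_big /= [X in _ - X](bigD1 i) //= eqxx mul1r.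
    rewrite [X in _ - (_ + X)]big1 ?addr0 => [|k ki]; last by rewrite eq_sym (negPf ki) mul0r.
    apply/eqP; rewrite subr_eq0 E1; apply/eqP; apply: eq_bigr => j _.
    by rewrite E2 mulr_sumr; apply: eq_bigr => k _; rewrite mulrA.
  rewrite eqxx => /eqP; rewrite subr_eq0 => /eqP/(congr1 (mcoeff 0%MM)).
  rewrite raddf_sum /= mcoeff1 eqxx => e1; apply: (etrans _ e1); apply: eq_bigr => j _.
  by rewrite rmorphM.
have MN := inv _ _ _ _ _ _ beta (fun j => proj1 (ME j)) (fun i => proj1 (NE i)).
have NM := inv _ _ _ _ _ _ bth (fun i => proj1 (NE i)) (fun j => proj1 (ME j)).
apply/allP => r _; apply/eqP; rewrite /=.
have cnt (s : seq nat) : (count_mem r s)%:R = \sum_(i < size s | nth 0%N s i == r) (1 : K).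
  by rewrite sumr_const -sum1_card -sum1_count (big_nth 0%N) big_mkord; congr (_ *+ _).
have eqK : ((count_mem r e)%:R : K) = (count_mem r e')%:R.
  rewrite !cnt; under eq_bigr => i _ do rewrite -(NM i).
  under [in RHS]eq_bigr => j _ do rewrite -(MN j).
  rewrite [LHS]big_mkcond [RHS]big_mkcond /=.
  transitivity (\sum_(i < size e) \sum_(j < size e')
      if nth 0%N e i == r then (N i j)@_0%MM * (M j i)@_0%MM else 0).
    by apply: eq_bigr => i _; case: ifP => // _; rewrite big1.
  rewrite exchange_big /=; apply: eq_bigr => j _.
  (* A nonzero constant term of [M j i] forces equal degrees, so the condition on [e] can be moved
     to [e']. *)
  have E (i : 'I_(size e)) : (if nth 0%N e i == r then (N i j)@_0%MM * (M j i)@_0%MM else 0) =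
     if nth 0%N e' j == r then (M j i)@_0%MM * (N i j)@_0%MM else 0.
    have [->|M0] := eqVneq ((M j i)@_0%MM) 0; first by rewrite mulr0 mul0r !if_same.
    by have [_ /(_ _ M0) ->] := ME j; rewrite mulrC.
  rewrite (eq_bigr _ (fun i _ => E i)); case: ifP => // _.
  by rewrite big1.
(* Characteristic 0 lifts the equality of multiplicities from [K] to [nat]. *)
have le a b : (a <= b)%N -> (a%:R : K) = b%:R -> a = b.
  move=> ab abK; apply/eqP; rewrite eqn_leq ab -subn_eq0; apply/eqP/char0.
  by rewrite natrB // abK subrr.
by case/orP: (leq_total (count_mem r e) (count_mem r e')) => /le; [apply|move=> h; apply/esym/h].
Qed.

Lemma exponentsE e : (forall m, (m%:R : K) = 0 -> m = 0%N) ->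
  sorted leq e -> has_exponents A e -> exponents A = e.
Proof.
move=> char0 se he; rewrite /exponents; case: xgetP => [e' _ [se' he']|/(_ e)].
  apply: (sorted_eq leq_trans anti_leq) => //.
  exact: has_exponents_perm.
by case.
Qed.

End Exponents.

(** * Families indexed by lists *)

Section BasisList.
Variables (K : fieldType) (V : vectType K).
Local Notation S := {mpoly K[\dim {:V}]}.
Variables (D : (S -> S) -> Prop) (n m : nat) (t : seq 'I_n) (E : m = size t).

(** Bases are required on several ordinals, of sizes [size e], [n] and [n - q]; the equation [E]
    lets the same list index all of them. *)
Definition list_index (k : 'I_m) : 'I_n := tnth (in_tuple t) (cast_ord E k).

Lemma list_indexE i0 (k : 'I_m) : list_index k = nth i0 t k.
Proof. by rewrite /list_index (tnth_nth i0). Qed.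

Lemma is_basis_list (J : pred 'I_n) (theta : 'I_n -> S -> S) : uniq t ->
  (forall i, (i \in t) = ~~ J i) ->
  (forall i, ~~ J i -> D (theta i)) ->
  (forall eta, D eta -> exists c : 'I_n -> S,
     forall p, eta p = \sum_(i | ~~ J i) c i * theta i p) ->
  (forall c : 'I_n -> S, (forall p, \sum_(i | ~~ J i) c i * theta i p = 0) ->
     forall i, ~~ J i -> c i = 0) ->
  is_basis D (fun k => theta (list_index k)).
Proof.
move=> ut tJ thD gen indep.
have tk k : list_index k \in t by apply: mem_tnth.
have inj : injective list_index.
  move=> k l; have i0 := list_index k; rewrite !(list_indexE i0) => /eqP.
  by rewrite nth_uniq // -?E // => /eqP/val_inj.
have sumE (F : 'I_n -> S) : \sum_(i | ~~ J i) F i = \sum_k F (list_index k).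
  rewrite -(eq_bigl _ _ tJ) -(big_uniq _ ut) (big_tnth _ _ t predT F) /= (reindex (cast_ord E)) //.
  by apply: onW_bij; exists (cast_ord (esym E)); [exact: cast_ordK | exact: cast_ordKV].
split.
- by move=> k; apply: thD; rewrite -tJ.
- move=> eta /gen[c cE]; exists (c \o list_index) => p.
  by rewrite cE sumE.
move=> c c0 k.
(* The coefficients are extended by 0 to all indices; the sum has at most one term, as [list_index]
   is injective. *)
pose c' i := \sum_(l | list_index l == i) c l.
have c'E l : c' (list_index l) = c l.
  by rewrite /c' (eq_bigl (pred1 l)) ?big_pred1_eq // => j; rewrite (inj_eq inj).
rewrite -c'E; apply: indep; last by rewrite -tJ.
by move=> p; rewrite sumE -[RHS](c0 p); apply: eq_bigr => l _; rewrite c'E.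
Qed.

End BasisList.

(** * The stages of the partition *)

Section Stages.
Variables (K : fieldType) (V : vectType K).
Local Notation n := (\dim {:V}).
Local Notation S := {mpoly K[n]}.
Variables (A : {fset {vspace V}}) (pi : seq {fset {vspace V}}).
Hypothesis hA : is_arrangement A.
Hypothesis hpi : is_MAT_partition A pi.

Lemma stage0 : stage pi 0 = fset0.
Proof. by rewrite /stage take0 big_nil. Qed.

Lemma stageS k : (k < size pi)%N -> stage pi k.+1 = (stage pi k `|` block pi k.+1)%fset.
Proof. by move=> kp; rewrite /stage (take_nth fset0) // -cats1 big_cat big_seq1. Qed.

Lemma stage_size : stage pi (size pi) = A.
Proof. by rewrite /stage take_size; case: hpi => -[_ _ ->]. Qed.

Lemma block_sub k : (block pi k `<=` A)%fset.
Proof.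
have [kp|kp] := ltnP k.-1 (size pi); last by rewrite /block nth_default ?fsub0set.
by rewrite -stage_size /stage take_size; apply: bigfcup_sup => //; apply: mem_nth.
Qed.

Lemma stage_sub k : (stage pi k `<=` A)%fset.
Proof.
rewrite -stage_size {2}/stage take_size.
by rewrite -[X in (_ `<=` \bigcup_(B <- X) _)%fset](cat_take_drop k) big_cat fsubsetUl.
Qed.

Lemma sub_arrangement (B : {fset {vspace V}}) : (B `<=` A)%fset -> is_arrangement B.
Proof. by move=> /fsubsetP BA H /BA /hA. Qed.

Lemma generic_point k : (k < size pi)%N ->
  exists2 v, v \in center (block pi k.+1) & forall H, H \in stage pi k -> v \notin H.
Proof.
case: hpi => _ /[apply] -[_ /existsNP[v /not_implyP[vC nH]] _].
by exists v => // H HA; apply/negP => vH; apply: nH; exists H.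
Qed.

Lemma MAT_stage k theta d : (k < size pi)%N -> stage_basis (stage pi k) k theta d ->
  exists f psi, adapted (stage pi k) (C := block pi k.+1) k f theta psi d /\
    stage_basis (stage pi k.+1) k.+1
      (scale_der (@nform _ _ (block pi k.+1)) f psi predT) (raise f d).
Proof.
move=> kp bth; have [v vC vA] := generic_point kp.
case: hpi => _ /(_ k kp)[rC _ cardA].
rewrite stageS //; apply: MAT_step vC vA _ => //; apply: sub_arrangement.
  exact: stage_sub.
exact: block_sub.
Qed.

Lemma stage_basis0 : stage_basis (stage pi 0) 0 (fun i q => mderiv i q) (fun _ => 0%N).
Proof.
have submm (m : 'X_{1..n}) : (m - m)%MM = 0%MM.
  by apply/mnmP => j; rewrite mnmBE mnm0E subnn.
rewrite stage0; split=> //.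
- move=> i; split; last by move=> H a; rewrite inE.
  by split=> [k f g|f g]; rewrite ?linearP ?mderivM.
- move=> i l; rewrite mderivX; have [->|il] := eqVneq (l : 'I_n) i.
    by rewrite mnm1E eqxx scale1r dhomogX; apply/eqP; rewrite submm; exact: mdeg0.
  by rewrite mnm1E (negPf il) scale0r dhomog0.
exists 1; rewrite mulr1 /prodlin big_map big_seq_fset0 (_ : der_mx _ _ = 1%:M) ?det1 //.
apply/matrixP => i l; rewrite !mxE linpoly_crd mderivX mnm1E eq_sym.
case: eqVneq => [->|_]; last by rewrite scale0r.
by rewrite scale1r submm mpolyX0.
Qed.

Lemma stage_basis_exists k : (k <= size pi)%N ->
  exists theta d, stage_basis (stage pi k) k theta d.
Proof.
elim: k => [_|k IH kp]; first by eexists; eexists; exact: stage_basis0.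
have [theta [d bth]] := IH (ltnW kp).
by have [f [psi [_ ?]]] := MAT_stage kp bth; eexists; eexists; eassumption.
Qed.

(* The later steps change only derivations of top degree, and the step after
   stage [k] adds to the others multiples of the [theta l] with [l] in [J]. *)
Lemma later_basis k theta d : (k <= size pi)%N -> stage_basis (stage pi k) k theta d ->
  exists (eta : 'I_n -> S -> S) (e : 'I_n -> nat) (J : pred 'I_n),
  [/\ stage_basis A (size pi) eta e, #|J| = #|` block pi k.+1|,
    forall i, J i -> d i = k /\ (k <= e i)%N,
    forall i, ~~ J i -> e i = d i /\
      forall X, (forall l q, J l -> resS X (theta l q) = 0) ->
        forall q, resS X (eta i q) = resS X (theta i q) &
    forall i, ~~ J i -> (d i < k)%N -> forall q, eta i q = theta i q].
Proof.
(* The induction is on the number of remaining steps. *)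
move=> kp; rewrite -(subKn kp); move: (size pi - k)%N (leq_subr k (size pi)) => r.
elim: r theta d {kp} => [|r IH] theta d rp bth.
  (* At the last stage the next block is the default value, the empty set, and [J] is empty
     accordingly. *)
  rewrite subn0 in bth *; exists theta, d, pred0; split=> //.
  - by rewrite stage_size in bth.
  - by rewrite eq_card0 // /block nth_default.
set k' := (size pi - r.+1)%N in bth *.
have kp : (k' < size pi)%N by rewrite /k' ltn_subrL (leq_trans _ rp).
have k'S : k'.+1 = (size pi - r)%N by rewrite /k' subnSK.
have [f [psi [[finj dfk [psiA psid dk _] _ rel] bS]]] := MAT_stage kp bth.
rewrite -k'S in IH; have [eta [e [J [beta _ Jd nJd low]]]] := IH _ _ (ltnW rp) bS.
have im_raise i : [exists j, f j == i] -> raise f d i = k'.+1.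
  by move=> ex; rewrite /raise ex; case/existsP: ex => j /eqP <-; rewrite dfk addn1.
have nim_raise i : ~~ [exists j, f j == i] -> raise f d i = d i.
  by rewrite /raise => /negPf->; rewrite addn0.
have nJ i : ~~ [exists j, f j == i] -> ~~ J i.
  move=> ni; apply/negP => /Jd[]; rewrite nim_raise // => dE _.
  by have := dk i; rewrite dE ltnn.
(* An index outside the image of [f] has degree at most [k'], below the top degree [k'.+1] of the
   next stage, so no later step changes its element. *)
have nim i : ~~ [exists j, f j == i] -> forall q, eta i q = psi i q.
  move=> ni q; rewrite low ?nJ ?nim_raise ?ltnS //.
  rewrite /scale_der scale_coefN ?mul1r // => j _.
  by move: ni; rewrite negb_exists => /forallP.
exists eta, e, [pred i | [exists j, f j == i]]; split=> //.
- rewrite -[RHS]card_ord -(card_codom finj); apply: eq_card => i.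
  by rewrite inE; apply/existsP/codomP => -[j]; [move=> /eqP <-|move=> ->]; exists j.
- move=> i /= ex; have /existsP[j /eqP fji] := ex; split; first by rewrite -fji.
  have [/Jd[_ /ltnW //]|/nJd[-> _]] := boolP (J i).
  by rewrite im_raise.
- move=> i /= ni; split; first by have [-> _] := nJd _ (nJ _ ni); rewrite nim_raise.
  move=> X X0 q; rewrite nim //.
  have [|t tE _] := rel i; first by move: ni; rewrite negb_exists => /forallP.
  rewrite tE resSD resS_sum big1 ?addr0 // => j _; rewrite resSZ X0 ?scaler0 //.
  by apply/existsP; exists j.
move=> i /= ni di q; rewrite nim //.
have [|t tE t0] := rel i; first by move: ni; rewrite negb_exists => /forallP.
by rewrite tE big1 ?addr0 // => j _; rewrite t0 // scale0r.
Qed.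

End Stages.

(** * Restricted derivations *)

Section RestrictedDerivations.
Variables (K : fieldType) (V : vectType K).
Local Notation S := {mpoly K[\dim {:V}]}.
Variables (X : {vspace V}).
Local Notation SX := {mpoly K[\dim {: subvs_of X}]}.

(** The result is computed on one particular lift; for [theta] tangent to [X] it does not depend on
    the lift ([restrict_derE]). *)
Definition restrict_der (theta : S -> S) (g : SX) : SX := resS X (theta (liftS g)).

Section Tangent.
Variable theta : S -> S.
Hypothesis dth : is_derivation theta.
Hypothesis thX : forall f, resS X f = 0 -> resS X (theta f) = 0.

Lemma restrict_derE : is_restricted_der theta (restrict_der theta).
Proof.
move=> f; rewrite /restrict_der; apply/eqP; rewrite -subr_eq0 -resSB -(derB dth).
by apply/eqP/thX; rewrite resSB liftSK subrr.
Qed.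

Lemma restrict_der_derivation : is_derivation (restrict_der theta).
Proof.
split=> [k f g|f g]; rewrite /restrict_der /liftS.
  by rewrite linearP /= (derP dth) resSD resSZ.
by rewrite rmorphM /= (derM dth) resSD !resSM -!/(liftS _) !liftSK.
Qed.

Lemma homog_restrict_der d : homog_der d theta -> homog_der d (restrict_der theta).
Proof.
move=> hth l; rewrite /restrict_der /liftS pullbackX.
by apply: dhomog_pullback; apply: homog_der_linpoly.
Qed.

End Tangent.

Lemma lker_incl (b : 'Hom(V, K^o)) :
  lker (b \o incl X)%VF = (linfun (@vsval K V X) @^-1: lker b)%VS.
Proof. by apply/vspaceP => x; rewrite -memv_preim !memv_ker comp_lfunE. Qed.

Lemma restrict_logder (A : {fset {vspace V}}) theta : is_arrangement A ->
  logder A theta -> (forall f, resS X f = 0 -> resS X (theta f) = 0) ->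
  logder (restriction A X) (restrict_der theta).
Proof.
move=> hA thA thX; have [dth _] := thA; apply/logderP; split.
  exact: restrict_der_derivation.
move=> a /imfsetP[H /= /andP[HA _] aH]; have kH := formK (hA _ HA).
have [k ->] : exists k : K, a = k *: (form H \o incl X)%VF.
  by apply: form_subT; rewrite aH lker_incl kH subvv.
set b := (form H \o incl X)%VF.
have [g gE] : exists g, theta (linpoly (form H)) = linpoly (form H) * g.
  by case: thA => _ /(_ H _ HA kH).
have -> : linpoly (k *: b) = k *: linpoly b by rewrite linearZ.
rewrite (derZ (restrict_der_derivation dth)).
rewrite -[linpoly b]resS_linpoly (restrict_derE dth thX) gE resSZ resSM resSM resS_linpoly -/b.
have [k0|k0] := eqVneq k 0; first by rewrite k0 [LHS]scale0r.
have /eqP -> : resS (lker (k *: b)) (linpoly b) == 0.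
  rewrite resS_linpoly_eq0; apply/subvP => x; rewrite !memv_ker scale_lfunE.
  by rewrite mulf_eq0 (negPf k0).
by rewrite mul0r scaler0.
Qed.

(** A hyperplane of [subvs_of X] is a subspace of a subspace; this brings vanishing on it back to
    [X :&: lker b] inside [V]. *)
Lemma resS_comp_eq0 f (b : 'Hom(V, K^o)) :
  resS (lker (b \o incl X)) (resS X f) = 0 -> resS (X :&: lker b) f = 0.
Proof.
rewrite /resS -pullback_comp; apply: pullback_limg_eq0.
rewrite (limg_incl (X :&: lker b)); apply/subvP => v; rewrite memv_cap memv_ker => /andP[vX vb].
have xb : vsproj X v \in lker (b \o incl X) by rewrite memv_ker comp_lfunE inclE vsprojK.
apply/memv_imgP; exists (vsproj _ (vsproj X v)); rewrite ?memvf // comp_lfunE.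
by rewrite -!/(incl _) !inclE vsprojK // vsprojK.
Qed.

End RestrictedDerivations.

Lemma subset_between (T : finType) (P Q : pred T) q :
  (forall x, P x -> Q x) -> (#|P| <= q <= #|Q|)%N ->
  exists r : seq T, [/\ uniq r, size r = q, forall x, P x -> x \in r &
    forall x, x \in r -> Q x].
Proof.
move=> PQ /andP[Pq qQ]; pose s := enum P ++ enum [predD Q & P].
have us : uniq s.
  rewrite cat_uniq !enum_uniq /= andbT; apply/hasPn => x.
  by rewrite !mem_enum => /andP[].
have sizes : size s = #|Q|.
  have -> : #|Q| = (#|[predI Q & P]| + #|[predD Q & P]|)%N.
    by rewrite addnC -(cardID P Q) addnC; congr (_ + _)%N; apply: eq_card => x; rewrite !inE.
  rewrite size_cat -!cardE; congr (_ + _)%N; apply: eq_card => x.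
  by rewrite !inE; apply/idP/andP => [Px|[_ ->//]]; split=> //; apply: PQ.
exists (take q s); split.
- exact: take_uniq.
- by rewrite size_takel // sizes.
- move=> x Px; rewrite take_cat -cardE ltnNge Pq /= mem_cat mem_enum.
  by rewrite [x \in P]Px.
move=> x /mem_take; rewrite mem_cat !mem_enum => /orP[/PQ //|].
by case/andP.
Qed.

(** * The restriction to X *)

Section DualForms.
Variables (K : fieldType) (V : vectType K).
Local Notation n := (\dim {:V}).
Local Notation S := {mpoly K[n]}.
Variables (A : {fset {vspace V}}) (m : nat) (psi : 'I_n -> S -> S) (d : 'I_n -> nat) (v : V).
Hypothesis hA : is_arrangement A.
Hypothesis psi_basis : stage_basis A m psi d.
Hypothesis Av : forall H, H \in A -> v \notin H.

Lemma evZ k (f : S) : ev v (k *: f) = k * ev v f.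
Proof. exact: mevalZ. Qed.

Lemma ev_sum (I : Type) (r : seq I) (P : pred I) (F : I -> S) :
  ev v (\sum_(i <- r | P i) F i) = \sum_(i <- r | P i) ev v (F i).
Proof. exact: raddf_sum. Qed.

(** The values of the [psi i] at [v] form a basis of [V], and [lam] is its dual basis. It matches
    the form of a hyperplane with the index of its derivation, as [restriction_chain] requires. *)
Lemma dual_forms : exists lam : 'I_n -> 'Hom(V, K^o),
  [/\ forall i l, ev v (psi i (linpoly (lam l))) = (i == l)%:R,
     forall a, a = \sum_l ev v (psi l (linpoly a)) *: lam l &
     exists g, prodlin (forms A) = \det (der_mx psi lam) * g].
Proof.
have [psiA _ _ [g gE]] := psi_basis.
have psid i : is_derivation (psi i) by case: (psiA i).
pose P : 'M[K]_n := \matrix_(i, l) ev v (psi i 'X_l).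
have Pu : P \in unitmx.
  have -> : P = map_mx (ev v) (der_mx psi (@crd K V)).
    by apply/matrixP => i l; rewrite !mxE linpoly_crd.
  rewrite unitmxE unitfE.
  by have := ev_det_neq0 hA psi_basis Av; rewrite /ev -det_map_mx.
pose Q := invmx P.
have evP i a : ev v (psi i (linpoly a)) = \sum_(l < n) a (vbasis {:V})`_l * P i l.
  by rewrite (der_linpoly (psid i)) ev_sum; apply: eq_bigr => l _; rewrite evZ mxE.
pose lam l : 'Hom(V, K^o) := \sum_(k < n) Q k l *: crd k.
have lamE l : linpoly (lam l) = \sum_k Q k l *: 'X_k.
  rewrite linear_sum; apply: eq_bigr => k _.
  by rewrite linearZ /= linpoly_crd.
have crdE k : crd k = \sum_l P l k *: lam l.
  apply: linpoly_inj; rewrite linear_sum /= linpoly_crd.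
  under eq_bigr => l _ do rewrite linearZ /= lamE scaler_sumr.
  rewrite exchange_big /= [RHS](bigD1 k) //= [X in _ + X]big1 ?addr0 => [|k' k'k]; last first.
    under eq_bigr => l _ do rewrite scalerA mulrC.
    rewrite -scaler_suml; have /matrixP/(_ k' k) := mulVmx Pu.
    by rewrite mxE [RHS]mxE (negPf k'k) => ->; rewrite scale0r.
  under eq_bigr => l _ do rewrite scalerA mulrC.
  rewrite -scaler_suml; have /matrixP/(_ k k) := mulVmx Pu.
  by rewrite mxE [RHS]mxE eqxx => ->; rewrite scale1r.
exists lam; split.
- move=> i l; rewrite lamE (der_sum (psid i)) ev_sum.
  have /matrixP/(_ i l) := mulmxV Pu; rewrite mxE [RHS]mxE => <-.
  by apply: eq_bigr => k _; rewrite (derZ (psid i)) evZ mulrC mxE.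
- move=> a; rewrite {1}[a]crd_span.
  under eq_bigr => k _ do rewrite crdE scaler_sumr.
  rewrite exchange_big /=; apply: eq_bigr => l _.
  by rewrite evP scaler_suml; apply: eq_bigr => k _; rewrite scalerA.
exists ((\det P)%:MP * g); rewrite gE mulrA; congr (_ * _).
rewrite -(det_map_mx (@mpolyC n K)) -det_mulmx; congr (\det _).
apply/matrixP => i k; rewrite !mxE linpoly_crd -[X in psi i X]linpoly_crd crdE.
rewrite linear_sum (der_sum (psid i)); apply: eq_bigr => l _.
by rewrite linearZ /= (derZ (psid i)) !mxE mulrC mul_mpolyC.
Qed.

End DualForms.

Lemma memv_bigcap (K : fieldType) (V : vectType K) (I : eqType) (r : seq I)
    (F : I -> {vspace V}) v :
  (v \in \bigcap_(i <- r) F i)%VS = all (fun i => v \in F i) r.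
Proof.
elim: r => [|i r IH]; first by rewrite big_nil memvf.
by rewrite big_cons memv_cap IH.
Qed.

Section Restriction.
Variables (K : fieldType) (V : vectType K).
Local Notation n := (\dim {:V}).
Local Notation S := {mpoly K[n]}.
Variables (A : {fset {vspace V}}) (pi : seq {fset {vspace V}}).
Hypothesis hA : is_arrangement A.
Hypothesis hpi : is_MAT_partition A pi.

(* [r] lists the indices attached to [C].  It contains the indices [J'] used at
   the step after [pi_k], so that the later modifications of the remaining basis
   elements vanish on [X]. *)
Lemma MAT_restriction k q : (k < size pi)%N ->
  (#|` block pi k.+2| <= q <= #|` block pi k.+1|)%N ->
  exists (C : {fset {vspace V}}) (r : seq 'I_n) (eta : 'I_n -> S -> S) (e : 'I_n -> nat),
  [/\ [/\ (C `<=` block pi k.+1)%fset, #|` C| = q, uniq r & size r = q],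
    stage_basis A (size pi) eta e,
    forall i, if i \in r then (k < e i)%N else (e i <= k.+1)%N,
    forall i f, resS (center C) f = 0 -> resS (center C) (eta i f) = 0 &
    (forall theta, logder (restriction A (center C)) theta -> exists c,
       forall p, theta p = \sum_(i | i \notin r) c i * restrict_der (eta i) p) /\
    (forall c, (forall p : {mpoly K[\dim {: subvs_of (center C)}]},
         \sum_(i | i \notin r) c i * restrict_der (eta i) p = 0) ->
       forall i, i \notin r -> c i = 0)].
Proof.
move=> kp hq; have [theta [d bth]] := stage_basis_exists hA hpi (ltnW kp).
have [v vC vA] := generic_point hpi kp.
have [f [psi [[finj dfk bpsi psiC _] bS]]] := MAT_stage hA hpi kp bth.
have [eta [e [J' [beta cardJ' J'd nJ' _]]]] := later_basis hA hpi kp bS.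
have C0A := block_sub hpi k.+1; have A0A := stage_sub hpi k.
set C0 := block pi k.+1 in hq vC f finj dfk psiC bS J'd nJ' C0A *.
set A0 := stage pi k in vA bpsi A0A.
have hC0 := sub_arrangement hA C0A; have hA0 := sub_arrangement hA A0A.
have [psiA psid dk _] := bpsi; have [etaA _ _ _] := beta.
pose Q := [pred i | [exists j, f j == i]].
have raiseQ i : raise f d i = (d i + Q i)%N by [].
have [||r [ur sr J'r rQ]] := @subset_between _ J' Q q.
(* An index in [J'] has degree [k.+1] after the step and at most [k] before it, so it lies in the
   image of [f]. *)
- move=> i /J'd[+ _]; rewrite raiseQ; case: (Q i) => //; rewrite addn0 => di.
  by have := dk i; rewrite di ltnn.
- have -> : #|Q| = #|` C0|.
    rewrite -[RHS]card_ord -(card_codom finj); apply: eq_card => i.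
    by rewrite inE; apply/existsP/codomP => -[j]; [move=> /eqP <-|move=> ->]; exists j.
  by rewrite cardJ'.
have rf i : i \in r -> exists j, i = f j by move=> /rQ/existsP[j /eqP <-]; exists j.
have vH H : H \in C0 -> v \in H by move=> HC; apply: subvP vC; apply: center_le.
have [lam [lamev lamspan lamdet]] := dual_forms hA0 bpsi vA.
(* For [l != f j], [psi l] is tangent to a hyperplane through [v], so its coefficient in the dual
   basis is zero and only the one at [f j] survives. *)
have nfE j : exists2 w : K, w != 0 & nform j = w *: lam (f j).
  exists (ev v (psi (f j) (linpoly (nform j)))); last first.
    rewrite {1}[nform j]lamspan (bigD1 (f j)) //= big1 ?addr0 // => l lj.
    rewrite (ev_on _ (psiC l j _)) ?scale0r // 1?eq_sym //.
    exact/vH/nform_mem.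
  apply/negP => /eqP w0; have /negP := hyperplane_not_full hC0 (nform_mem j hC0); apply.
  apply/subvP => x _; rewrite memv_ker [nform j]lamspan (bigD1 (f j)) //= w0 scale0r add0r.
  rewrite big1 ?zero_lfunE // => l lj.
  rewrite (ev_on _ (psiC l j _)) ?scale0r // 1?eq_sym //.
  exact/vH/nform_mem.
have kerE j : lker (lam (f j)) = lker (nform j).
  have [w w0 ->] := nfE j; apply/vspaceP => x.
  by rewrite !memv_ker scale_lfunE scaler_eq0 (negPf w0).
pose D := [pred j | f j \notin r].
pose Xr := (\bigcap_(i <- r) lker (lam i))%VS.
have kerC0 i : i \in r -> lker (lam i) \in C0.
  by move=> /rf[j ->]; rewrite kerE nform_mem.
have kerA i : i \in r -> lker (lam i) \in A by move=> /kerC0; apply: (fsubsetP C0A).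
have nf_inj j j' : lker (@nform _ _ C0 j) = lker (nform j') -> j = j'.
  rewrite !nformK // => /eqP; rewrite nth_uniq ?fset_uniq // => /eqP jj.
  exact: val_inj.
pose C := seq_fset tt [seq lker (lam i) | i <- r].
have memC H : (H \in C) = (H \in [seq lker (lam i) | i <- r]) by rewrite seq_fsetE.
have memCf j : (lker (@nform _ _ C0 j) \in C) = (f j \in r).
  rewrite memC; apply/mapP/idP => [[i ir]|fr]; last by exists (f j) => //; rewrite kerE.
  by have [j' ij] := rf i ir; rewrite ij kerE => /nf_inj ->; rewrite -ij.
have XE : center C = Xr.
  apply/vspaceP => x; rewrite !memv_bigcap; apply/allP/allP => h.
    by move=> i ir; apply: h; rewrite memC; apply: map_f.
  by move=> H; rewrite memC => /mapP[i ir ->]; apply: h.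
have Xlam i : i \in r -> (Xr <= lker (lam i))%VS.
  by move=> ir; apply/subvP => x; rewrite memv_bigcap => /allP; apply.
(* Over [B] the [psi (f j)] with hyperplane in [C] stay unscaled, and no member of [B] contains
   [X]. *)
pose B := (stage pi k.+1 `\` C)%fset.
have BD H : H \in B -> H \in A0 \/ exists2 j, D j & H = lker (@nform _ _ C0 j).
  rewrite inE (stageS kp) inE => /andP[HC /orP[|HC0]]; [by left|right].
  have [j jE] := nformP hC0 HC0; exists j => //.
  by rewrite inE /= -memCf -jE.
have BA : (B `<=` A)%fset by apply: fsubset_trans (fsubsetDl _ _) (stage_sub hpi _).
have hB := sub_arrangement hA BA.
pose psiB := scale_der (@nform _ _ C0) f psi D.
have psiBB i : logder B (psiB i).
  by apply: (scale_der_logder psiA psiC) => H; exact: BD.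
have prodB : prodlin (forms B) = prodlin (forms A0) * \prod_(j | D j) linpoly (@nform _ _ C0 j).
  have nD j : lker (@nform _ _ C0 j) \notin A0.
    by apply/negP => /vA; rewrite vH // nform_mem.
  have perm : perm_eq B (A0 ++ [seq lker (@nform _ _ C0 j) | j <- enum D]).
    apply: uniq_perm; first exact: fset_uniq.
      rewrite cat_uniq fset_uniq /= map_inj_uniq ?enum_uniq ?andbT //.
      by apply/hasPn => _ /mapP[j _ ->]; apply: nD.
    move=> H; rewrite mem_cat; apply/idP/orP => [/BD[HA|[j Dj HE]]|[HA|/mapP[j + HE]]].
    - by left.
    - by right; rewrite HE; apply: map_f; rewrite mem_enum.
    - rewrite inE (stageS kp) inE HA andbT memC; apply/mapP => -[i ir HE].
      by have := vA _ HA; rewrite HE (vH _ (kerC0 _ ir)).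
    rewrite mem_enum => Dj; rewrite inE (stageS kp) inE HE memCf nform_mem // orbT andbT.
    exact: Dj.
  rewrite /prodlin !big_map (perm_big _ perm) big_cat /= big_map big_enum /=.
  congr (_ * _); apply: eq_bigr => j _; rewrite nformK //.
have detB : exists g, prodlin (forms B) = \det (der_mx psiB lam) * g.
  by have [g gE] := lamdet; exists g; rewrite prodB det_scale_der gE mulrC mulrA.
have psiBlam i j : j \in r -> i != j -> resS (lker (lam j)) (psiB i (linpoly (lam j))) = 0.
  move=> /rf[j0 ->] ij; have [w w0 wE] := nfE j0.
  have -> : lam (f j0) = w^-1 *: nform j0 by rewrite wE scalerA mulVf // scale1r.
  have -> : lker (w^-1 *: nform j0) = lker (nform j0).
    by apply/vspaceP => x; rewrite !memv_ker scale_lfunE scaler_eq0 invr_eq0 (negPf w0).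
  have [di _] := psiBB i; rewrite linearZ /= (derZ di) resSZ /psiB /scale_der resSM.
  by rewrite psiC 1?eq_sym // mulr0 scaler0.
(* This is the value of [psi l] at [v] as a vector. For [j] in [D], [x (f j)] lies in [Xr] but not
   on the hyperplane of index [j], which therefore does not contain [Xr]. *)
pose x l := \sum_(i < n) ev v (psi l 'X_i) *: (vbasis {:V})`_i.
have xE l (a : 'Hom(V, K^o)) : a (x l) = ev v (psi l (linpoly a)).
  have [dl _] := psiA l; rewrite (der_linpoly dl) linear_sum ev_sum.
  by apply: eq_bigr => i _; rewrite linearZ /= evZ mulrC.
have nvB b : b \in forms B -> ~~ (Xr <= lker b)%VS.
  move=> /(form_mem hB)/BD[bA|[j Dj bE]]; apply/negP => /subvP Xb.
    have /negP := vA _ bA; apply; apply: Xb; rewrite memv_bigcap.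
    by apply/allP => i ir; apply/vH/kerC0.
  have : x (f j) \in lker b.
    apply: Xb; rewrite memv_bigcap; apply/allP => i ir.
    have fi : f j != i by apply: contraNneq Dj => ->.
    by rewrite memv_ker xE lamev (negPf fi).
  by rewrite bE -kerE memv_ker xE lamev eqxx oner_eq0.
have uB : uniq (map (fun b => lker b) (forms B)) by rewrite map_lker_forms // fset_uniq.
have [||s [sB us [g gE]]] :=
  @restriction_chain K V n psiB lam (forms B) _ _ uB detB r ur psiBlam nvB.
- by move=> i; case: (psiBB i).
- by move=> i b; apply: logder_dvd.
have tang i g' : resS Xr g' = 0 -> resS Xr (eta i g') = 0.
  have /logderP[di h] := etaA i; apply: tangent_cap => // l lr.
  exact/h/kerA.
have nJ i : i \notin r -> ~~ J' i by apply: contra => /J'r.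
have kil l p : J' l -> resS Xr (scale_der (@nform _ _ C0) f psi predT l p) = 0.
  move=> /J'r lr; have [j lj] := rf l lr; rewrite lj /scale_der scale_coefE // resSM.
  have /eqP-> : resS Xr (linpoly (@nform _ _ C0 j)) == 0.
    by rewrite resS_linpoly_eq0 -kerE -lj Xlam.
  by rewrite mul0r.
(* For [i] outside [r], scaling by [D] and by [predT] gives the same factor. *)
have etaE i p : i \notin r -> resS Xr (eta i p) = resS Xr (psiB i p).
  move=> ir; have [_ h] := nJ' i (nJ i ir); rewrite h //.
  rewrite /psiB /scale_der; congr (resS _ (_ * _)); apply: eq_bigl => j /=.
  by case: eqVneq => [->|]; rewrite ?ir ?andbF.
exists C, r, eta, e; split=> //.
- split=> //; first by apply/fsubsetP => H; rewrite memC => /mapP[i ir ->]; apply: kerC0.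
  rewrite size_seq_fset undup_id ?size_map // map_inj_in_uniq // => i i' /rf[j ->] /rf[j' ->].
  by rewrite !kerE => /nf_inj ->.
- move=> i; case: ifPn => ir.
    have [/J'd[] //|/nJ'[-> _]] := boolP (J' i).
    by have [j lj] := rf i ir; have := rQ i ir; rewrite raiseQ lj dfk => ->; rewrite addn1.
  have [-> _] := nJ' i (nJ i ir); by have [_ _ ->] := bS.
- by rewrite XE.
rewrite XE; pose lamX l := (lam l \o incl Xr)%VF.
pose etaX i := restrict_der (X := Xr) (eta i).
have NE : mask_rows (fun i => i \in r) (der_mx etaX lamX) =
    map_mx (resS Xr) (mask_rows (mem r) (der_mx psiB lam)).
  apply/matrixP => i l; rewrite !mxE /=; case: ifPn => ir; first by rewrite rmorph_nat.
  rewrite -[linpoly (lamX l)]resS_linpoly /etaX restrict_derE ?etaE //.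
    by case: (etaA i).
  exact: tang.
have detN : \det (mask_rows (fun i => i \in r) (der_mx etaX lamX)) =
    resS Xr (\det (mask_rows (mem r) (der_mx psiB lam))).
  by rewrite NE det_map_mx.
have nvs b : b \in s -> ~~ (Xr <= lker b)%VS by move=> /sB/nvB.
have etaXB i : i \notin r -> logder (restriction A Xr) (etaX i).
  by move=> _; apply: restrict_logder hA (etaA i) (tang i).
have lamXr l : l \in r -> lamX l = 0.
  move=> lr; apply/lfunP => y; rewrite comp_lfunE inclE zero_lfunE; apply/eqP.
  by rewrite -memv_ker (subvP (Xlam l lr)) ?subvsP.
have lamX_span (a : 'Hom(subvs_of Xr, K^o)) : exists w : 'I_n -> K, a = \sum_l w l *: lamX l.
  pose b := (a \o linfun (vsproj Xr))%VF.
  exists (fun l => ev v (psi l (linpoly b))); apply/lfunP => y.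
  have -> : a y = b (vsval y) by rewrite comp_lfunE lfunE /= vsvalK.
  rewrite {1}[b]lamspan !sum_lfunE; apply: eq_bigr => l _.
  by rewrite !scale_lfunE comp_lfunE inclE.
have det0 : \det (mask_rows (fun i => i \in r) (der_mx etaX lamX)) != 0.
  have := resS_prodlin_neq0 nvs; rewrite gE resSM mulf_eq0 negb_or detN.
  by case/andP.
have det_dvd (p : {mpoly K[\dim {: subvs_of Xr}]}) :
    (forall a : 'Hom(subvs_of Xr, K^o), a != 0 -> lker a \in restriction A Xr ->
       resS (lker a) p = 0) ->
    exists g', p = \det (mask_rows (fun i => i \in r) (der_mx etaX lamX)) * g'.
  (* The forms in [s] have distinct traces, all in the restriction of [A]; so their product divides
     [p] on [Xr], and the determinant divides this product. *)
  move=> p0; have [h hE] : dvd_on Xr (prodlin s) (liftS p).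
    apply: prodlin_dvd_on => // b bs; apply: dvd_on_ker; apply: resS_comp_eq0.
    rewrite liftSK; apply: p0.
      apply: contraNneq (nvs b bs) => b0; rewrite -resS_linpoly_eq0 resS_linpoly b0.
      by rewrite linear0.
    apply/imfsetP; exists (lker b); last by rewrite lker_incl.
    by rewrite !inE nvs // andbT (fsubsetP BA) // form_mem // sB.
  exists (resS Xr g * resS Xr h); rewrite -[LHS]liftSK hE resSM gE resSM detN.
  by rewrite mulrA.
split.
- move=> th; exact: (saito_span etaXB lamXr lamX_span det0 det_dvd).
- move=> c; exact: (saito_free det0).
Qed.

End Restriction.

(** * Bases and exponents in the required order *)

Lemma real_or_complex_char0 (K : fieldType) : real_or_complex K ->
  forall m, (m%:R : K) = 0 -> m = 0%N.
Proof.
move=> [R hR] m m0; case: hR => -[f [g fK _]].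
  have : f m%:R = f 0 by rewrite rmorph_nat rmorph0.
  by move/(can_inj fK)/eqP; rewrite pnatr_eq0 => /eqP.
have : f m%:R = f 0 by rewrite rmorph_nat rmorph0.
by move/(can_inj fK)/eqP; rewrite pnatr_eq0 => /eqP.
Qed.

(** Saito's criterion is applied with the empty mask. *)
Lemma stage_basis_list (K : fieldType) (V : vectType K) (A : {fset {vspace V}}) m
    eta e (p : nat) (t : seq 'I_(\dim {:V})) (E : p = size t) :
  is_arrangement A -> stage_basis A m eta e -> uniq t -> (forall i, i \in t) ->
  is_basis (logder A) (fun k => eta (list_index E k)).
Proof.
move=> hA [etaA _ _ [g gE]] ut tt.
pose J : pred 'I_(\dim {:V}) := pred0.
have maskE : mask_rows J (der_mx eta (@crd K V)) = der_mx eta (@crd K V).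
  by apply/matrixP => i l; rewrite !mxE.
have det0 : \det (mask_rows J (der_mx eta (@crd K V))) != 0.
  have nv b : b \in forms A -> ~~ (fullv <= lker b)%VS.
    by move=> /(form_mem hA); apply: hyperplane_not_full.
  rewrite maskE; have := resS_prodlin_neq0 nv; rewrite gE.
  by apply: contraNneq => ->; rewrite mul0r resS0.
have det_dvd (f : {mpoly K[\dim {:V}]}) :
    (forall a : 'Hom(V, K^o), a != 0 -> lker a \in A -> resS (lker a) f = 0) ->
    exists h, f = \det (mask_rows J (der_mx eta (@crd K V))) * h.
  move=> f0; have [a aA|h hE] := forms_dvd (f := f) hA.
    apply: f0 => //; apply: contraTneq (hyperplane_not_full hA aA) => ->.
    by rewrite negbK; apply/subvP => x _; rewrite memv_ker zero_lfunE.
  by exists (g * h); rewrite hE gE maskE mulrA.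
have span (a : 'Hom(V, K^o)) : exists w : 'I_(\dim {:V}) -> K, a = \sum_l w l *: crd l.
  by exists (fun l => a (vbasis {:V})`_l); apply: crd_span.
have etaJ i : ~~ J i -> logder A (eta i) by move=> _; apply: etaA.
have crdJ l : J l -> crd l = 0 :> 'Hom(V, K^o) by [].
apply: (@is_basis_list _ _ (logder A) _ p t E J) => //.
- exact: (saito_span etaJ crdJ span det0 det_dvd).
exact: (saito_free det0).
Qed.

Theorem theorem3p9 (K : fieldType) (hK : real_or_complex K) (V : vectType K)
    (A : {fset {vspace V}}) (pi : seq {fset {vspace V}})
    (hA : is_arrangement A) (hpi : is_MAT_partition A pi)
    (k q : nat) (hk : (1 <= k <= size pi)%N)
    (hq : (#|` block pi k.+1| <= q <= #|` block pi k|)%N) :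
  exists C : {fset {vspace V}},
    [/\ (C `<=` block pi k)%fset, #|` C| = q &
      let X := center C in
      [/\ is_free (restriction A X),
          exponents (restriction A X) = take (\dim {:V} - q) (exponents A) &
        exists theta : 'I_(\dim {:V}) ->
            {mpoly K[\dim {:V}]} -> {mpoly K[\dim {:V}]},
          is_basis (logder A) theta /\
          exists thetaX : 'I_(\dim {:V} - q) ->
              {mpoly K[\dim {: subvs_of X}]} -> {mpoly K[\dim {: subvs_of X}]},
            (forall i, is_restricted_der
               (theta (widen_ord (leq_subr q (\dim {:V})) i)) (thetaX i)) /\
            is_basis (logder (restriction A X)) thetaX]].
Proof.
case: k hk hq => [//|k] /= kp hq.
have [C [r [eta [e [[CC0 cC ur sr] beta er tang [span free]]]]]] := MAT_restriction hA hpi kp hq.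
exists C; split=> //; set X := center C.
have [etaA etae _ _] := beta.
pose n := \dim {:V}; pose le_e := relpre e leq.
(* By [er] the degrees outside [r] are at most [k.+1] and those in [r] at least [k.+1]. Hence
   sorting the two parts sorts the whole list, and its first [n - q] entries are the indices that
   survive on [X]. *)
pose s1 := sort le_e (enum [pred i | i \notin r]); pose s2 := sort le_e r.
pose t := s1 ++ s2.
have le_e_total : total le_e by move=> i j; apply: leq_total.
have s1r i : (i \in s1) = (i \notin r) by rewrite mem_sort mem_enum inE.
have us1 : uniq s1 by rewrite sort_uniq enum_uniq.
have ut : uniq t.
  rewrite cat_uniq us1 sort_uniq ur andbT; apply/hasPn => i.
  by rewrite mem_sort s1r => ->.
have tt i : i \in t by rewrite mem_cat s1r mem_sort orNb.
have st : n = size t.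
  by rewrite -(card_uniqP ut) -[LHS](card_ord n); apply: eq_card => i; rewrite tt.
have ss1 : (n - q)%N = size s1 by rewrite st size_cat !size_sort sr addnK.
have basisA p (E : p = size t) := stage_basis_list E hA beta ut tt.
have basisX p (E : p = size s1) : is_basis (logder (restriction A X))
    (fun i => restrict_der (X := X) (eta (list_index E i))).
  apply: (@is_basis_list _ _ _ _ p s1 E (fun i => i \in r) (fun i => restrict_der (eta i))) => //.
  by move=> i _; apply: restrict_logder hA (etaA i) (tang i).
pose ex (s : seq 'I_n) := map e s.
have expA : has_exponents A (ex t).
  exists (fun i => eta (list_index (size_map e t) i)); split; first exact: basisA.
  move=> i; have i0 := list_index (size_map e t) i.
  rewrite (nth_map i0) -?(list_indexE (size_map e t)) //.
  exact: leq_trans (ltn_ord i) (eq_leq (size_map e t)).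
have expX : has_exponents (restriction A X) (ex s1).
  exists (fun i => restrict_der (X := X) (eta (list_index (size_map e s1) i))).
  split; first exact: basisX.
  move=> i; have i0 := list_index (size_map e s1) i.
  rewrite (nth_map i0) -?(list_indexE (size_map e s1)) //.
    by apply: homog_restrict_der => //; case: (etaA (list_index (size_map e s1) i)).
  exact: leq_trans (ltn_ord i) (eq_leq (size_map e s1)).
have sorted_ex s : sorted leq (ex (sort le_e s)).
  by rewrite sorted_map; apply: sort_sorted.
have sorted_t : sorted leq (ex t).
  rewrite /ex map_cat sorted_pairwise ?pairwise_cat; last exact: leq_trans.
  rewrite -!(sorted_pairwise leq_trans) !sorted_ex !andbT.
  apply/allrelP => _ _ /mapP[i + ->] /mapP[j + ->].
  rewrite s1r mem_sort => ir jr; have := er i; have := er j.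
  by rewrite jr (negPf ir) => kj ik; apply: leq_trans ik kj.
have char0 := real_or_complex_char0 hK.
split.
- by exists (size s1), (fun i => restrict_der (X := X) (eta (list_index (erefl _) i))).
- rewrite (exponentsE char0 sorted_t expA) (exponentsE char0 (sorted_ex _) expX).
  by rewrite /ex map_cat take_size_cat // size_map ss1.
exists (fun i => eta (list_index st i)); split; first exact: basisA.
exists (fun i => restrict_der (X := X) (eta (list_index ss1 i))); split; last exact: basisX.
move=> i; have -> : list_index st (widen_ord (leq_subr q (\dim {:V})) i) = list_index ss1 i.
  have i0 := list_index ss1 i.
  rewrite (list_indexE st i0) (list_indexE ss1 i0) /= nth_cat.
  by rewrite -ss1 ltn_ord.
by apply: restrict_derE; [case: (etaA (list_index ss1 i)) | exact: tang].
Qed.
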